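(* Let $L$ be a skew free $(p,q)$-leaper. Then $L$ tours all boards of width $4pq$ and sufficiently large height; that is, there exists a positive integer $m_0$ (depending on $p$ and $q$) such that for every integer $m \ge m_0$ the leaper $L$ tours the board of size $m \times 4pq$.
   Context: The $(p,q)$-leaper is skew and free when $p$ and $q$ are positive integers, $p \ne q$, $p+q$ is odd, and $\gcd(p,q)=1$. A cell is an ordered pair of integers $(x,y)$; a board is a Cartesian product $I \times J$ of two nonempty finite intervals of integers. A board of size $m \times n$ has $m$ rows (its height, $|J| = m$) and $n$ columns (its width, $|I| = n$). The leaper graph of the $(p,q)$-leaper $L$ on a board $A$ is the undirected graph whose vertices are the cells of $A$, where cells $(x',y')$ and $(x'',y'')$ are adjacent if and only if $\{|x'-x''|,|y'-y''|\}=\{p,q\}$. $L$ tours $A$ when the leaper graph of $L$ on $A$ has a Hamiltonian cycle (a cycle through every vertex exactly once, with at least three vertices). *)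

(* Defs.v *)
From mathcomp Require Import all_boot all_order all_algebra.

Set Implicit Arguments.
Unset Strict Implicit.
Unset Printing Implicit Defensive.

Import Order.TTheory GRing.Theory Num.Theory.

Definition skew_free (p q : nat) : Prop :=
  [/\ 0 < p, 0 < q, p != q, odd (p + q) & gcdn p q = 1].

Definition cell : Type := (int * int)%type.

(* The product of the integer intervals [xmin, xmax] and [ymin, ymax]. *)
Record board : Type := Board {
  xmin : int;
  xmax : int;
  ymin : int;
  ymax : int;
  board_x : (xmin <= xmax)%R;
  board_y : (ymin <= ymax)%R
}.

Definition cells (B : board) : pred cell :=
  fun c => (xmin B <= c.1 <= xmax B)%R && (ymin B <= c.2 <= ymax B)%R.

Definition width (B : board) : nat := `|xmax B - xmin B|%N.+1.

Definition height (B : board) : nat := `|ymax B - ymin B|%N.+1.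

(* {dx, dy} = {p, q} as an equality of unordered pairs. *)
Definition leaper_adj (p q : nat) : rel cell :=
  fun c d =>
    let dx := `|c.1 - d.1|%N in
    let dy := `|c.2 - d.2|%N in
    (dx == p) && (dy == q) || (dx == q) && (dy == p).

(* The graph is the one induced by the relation e on the vertex set V; a cycle
   is listed without repeating its first vertex, and the bound on the size
   excludes the degenerate closed walks that ucycle accepts. *)
Definition hamiltonian_cycle (T : eqType) (V : pred T) (e : rel T) (s : seq T) :
  Prop := [/\ 2 < size s, ucycle e s & s =i V].

Definition tours (p q : nat) (B : board) : Prop :=
  exists s : seq cell, hamiltonian_cycle (cells B) (leaper_adj p q) s.

(* Main.v *)
Require Import Defs.
From mathcomp Require Import all_boot all_order all_algebra.
From mathcomp Require Import zify.

(** Let p < q and W = 4pq. The tour is obtained from a two-factor of the board,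
    a spanning subgraph in which every cell has degree two, by merging its cycles
    until only one is left; a connected two-factor is a Hamiltonian cycle
    (connected_hamiltonian).

    The middle of the board. Pair the columns into dominoes {x, x + p}, and let
    tau exchange the two columns of a domino. Joining (x, y) to (tau x, y + q)
    and to (tau x, y - q) makes every cell of the middle part lie on a vertical
    zigzag, a strand. The strand of (x, y) depends on x and on y modulo 2q only.
    Strands are merged by switches: given closed walks that alternate between
    edges of the two-factor and other leaps, the former are deleted and the
    latter are inserted, so that all degrees remain two. The relation merges s s' says
    that every two-factor with a tall enough zone of strands can be changed
    inside that zone so that connected cells stay connected and the strands s
    and s' become connected. As zones can be stacked, this is an equivalence
    relation, and merges already known may be used while checking the effect of
    a new switch (shape_merges).

    A four-cycle merges (x, y) with (x + q, y + p) when x and x + q lie on the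
    same side of their dominoes (merges_rung), an eight-cycle merges (x, y) with
    (x + 2p, y) in the same situation (merges_2p). For other columns x, the
    switch runs along the border of a triangle of dominoes: its apex is the
    domino of x, its legs leave through the columns x + a (q - p) and
    x + a (q + p), and its base lies where the four-cycles are available
    (tri_merges). The height of the triangle is less than p because q is not
    congruent to p modulo 2 (level_exists), so the triangle fits into the board
    if x is in the left half, and the right half is treated by reflection.
    Hence strands that differ by a leap merge, and since the leaps connect the
    strip, all strands merge (merges_any).

    The ends of the board. Colour the cells (x, y) by the parity of x + y; every
    leap changes the colour. Let the coloured rows form a graph by steps of p
    and q. Lifting a step of q with tau and a step of p with the exchange of
    columns x and x + q turns a two-regular graph on coloured rows into a
    two-factor. The graph chosen at the bottom has only steps of q above a
    certain row (half_pure), and each of its components climbs to that row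
    (escapes_any). Its mirror image closes the top of the board, so every cycle
    of the two-factor meets the zone of strands, whatever the height is. *)

Set Implicit Arguments.
Unset Strict Implicit.
Unset Printing Implicit Defensive.

Import Order.TTheory GRing.Theory Num.Theory.

(** * Graphs all of whose degrees are two *)

Section TwoRegular.

Variable T : eqType.
Implicit Types (F G e : rel T) (u v w : T) (s : seq T).

(** Cells range over an infinite type, so connection is stated by means of
    paths rather than by a decision procedure on a finite graph. *)
Definition conn F u v : Prop := exists2 s, path F u s & last u s = v.

Definition two_nbrs F u : Prop :=
  exists a b, a != b /\ forall v, F u v = (v == a) || (v == b).

Lemma conn0 F u : conn F u u.
Proof. by exists [::]. Qed.

Lemma conn1 F u v : F u v -> conn F u v.
Proof. by move=> Fuv; exists [:: v] => //=; rewrite Fuv. Qed.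

Lemma conn_trans F v u w : conn F u v -> conn F v w -> conn F u w.
Proof.
move=> [s Fs <-] [t Ft <-]; exists (s ++ t); last by rewrite last_cat.
by rewrite cat_path Fs.
Qed.

Lemma conn_sym F u v : symmetric F -> conn F u v -> conn F v u.
Proof.
move=> symF [s Fs <-]; elim: s u Fs => [|x s IH] u /=; first by move=> _; apply: conn0.
case/andP=> Fux /IH Fx; apply: conn_trans Fx _.
by apply: conn1; rewrite symF.
Qed.

Lemma conn_ind F (P : T -> Prop) u :
  (forall v w, P v -> F v w -> P w) -> P u -> forall v, conn F u v -> P v.
Proof.
move=> PF Pu v [s Fs <-]; elim: s u Pu Fs => [|x s IH] u //= Pu /andP[Fux Fs].
exact: IH (PF _ _ Pu Fux) Fs.
Qed.

Lemma two_nbrsE F u v w : two_nbrs F u -> F u v -> F u w -> v != w ->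
  forall t, F u t = (t == v) || (t == w).
Proof.
move=> [a [b [_ Fu]]]; rewrite !Fu.
by case/orP=> /eqP-> /orP[]/eqP->; rewrite ?eqxx // => _ t; rewrite Fu // orbC.
Qed.

Section Finite.

Variables (F : rel T) (V : seq T).
Hypotheses (symF : symmetric F) (irrF : irreflexive F).
Hypothesis FV : forall u v, F u v -> u \in V.
Hypothesis F2 : forall u, u \in V -> two_nbrs F u.

Lemma maximal_path u p : path F u p -> uniq (u :: p) -> u \in V ->
  exists p', [/\ path F u p', uniq (u :: p') &
                 forall w, F (last u p') w -> w \in u :: p'].
Proof.
have [n] := ubnP (size V - size p); elim: n p => // n IH p lt_n Fp Up uV.
have [/allP maxp|] := boolP (all (fun w => F (last u p) w ==> (w \in u :: p)) V).
  exists p; split=> // w Fw; have wV : w \in V by rewrite symF in Fw; apply: FV Fw.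
  by have := maxp w wV; rewrite Fw.
case/allPn=> w wV; rewrite negb_imply => /andP[Fw wp].
have Up' : uniq (u :: rcons p w) by rewrite -rcons_cons rcons_uniq wp.
have Fp' : path F u (rcons p w) by rewrite rcons_path Fp.
apply: (IH (rcons p w)) => //.
have subV : {subset u :: p <= V}.
  move=> x; rewrite inE => /orP[/eqP->//|].
  elim: (p) (u) Fp => //= y s IHs z /andP[Fzy Fs]; rewrite inE => /orP[/eqP->|].
    by rewrite symF in Fzy; apply: FV Fzy.
  exact: IHs Fs.
have /= := uniq_leq_size Up subV; rewrite size_rcons; lia.
Qed.

(** A longest simple path from a vertex must close up at its start: its last
    vertex has a second neighbour on the path, and any other vertex of the path
    already has two. *)
Lemma cycle_through u : u \in V ->
  exists s, [/\ 2 < size s, ucycle F s, u \in s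
              & forall v w, v \in s -> F v w -> w \in s].
Proof.
move=> uV; have [|||p [Fp Up maxp]] := @maximal_path u [::] => //.
have [s [s2 Us us]] : exists s, [/\ 2 < size s, ucycle F s & u \in s].
  case/lastP: p Fp Up maxp => [|p w] Fp Up maxp.
    have [a [b [_ Fu]]] := F2 uV; have Fua : F u a by rewrite Fu eqxx.
    by have := maxp a Fua; rewrite inE => /eqP aE; rewrite aE irrF in Fua.
  rewrite last_rcons in maxp; rewrite rcons_path in Fp; case/andP: Fp => Fp Ftw.
  have wV : w \in V by rewrite symF in Ftw; apply: FV Ftw.
  have [t2 Fwt2 t2N] : exists2 t2, F w t2 & t2 != last u p.
    have [a [b [neq_ab Fw]]] := F2 wV.
    have [aE|?] := eqVneq a (last u p); last by exists a => //; rewrite Fw eqxx.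
    by exists b; rewrite ?Fw ?eqxx ?orbT // -aE eq_sym.
  have := maxp t2 Fwt2; rewrite inE mem_rcons inE.
  have [t2u _|t2u /=] := eqVneq t2 u.
    exists (u :: rcons p w); split; last by rewrite mem_head.
      by case: p t2N {Ftw Fp Up maxp} => [|x p] //=; rewrite ?t2u ?eqxx ?size_rcons.
    rewrite /ucycle Up andbT /= rcons_path last_rcons rcons_path Fp Ftw /=.
    by rewrite -t2u.
  have [t2w|t2w /= t2p] := eqVneq t2 w; first by rewrite t2w irrF in Fwt2.
  case/splitPr: t2p Fp Up t2N {maxp Ftw} => p1 [|y p2].
    by rewrite last_cat /= eqxx.
  rewrite cat_path => /andP[_ /and3P[Fxt Fty _]] Up _; exfalso.
  have t2V : t2 \in V by apply: FV Fty.
  have xy : last u p1 != y.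
    apply: contraTneq Up => <-; rewrite -rcons_cons rcons_uniq -cat_cons cat_uniq /=.
    by rewrite mem_last !orbT !andbF.
  have := two_nbrsE (F2 t2V) _ Fty xy w; rewrite (symF t2) Fxt (symF t2) Fwt2.
  move=> /(_ isT)/esym; move: Up; rewrite -rcons_cons rcons_uniq -cat_cons.
  rewrite mem_cat negb_or !inE => /andP[/andP[wN1 wN2] _] /orP[/eqP wE|/eqP wE].
    by rewrite wE -in_cons mem_last in wN1.
  by rewrite wE eqxx !orbT in wN2.
exists s; split=> // v w vs Fvw.
have [i s' rotE] := rot_to vs.
rewrite -(mem_rot i) rotE.
move: s2 Us; rewrite -(size_rot i) -(rot_ucycle i) rotE.
case: s' {rotE} => [|y [|z s']] //= _; rewrite /ucycle /= rcons_path.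
case/andP=> /and4P[Fvy _ _ Flv] /and4P[vN yN _ _].
have vV := FV Fvy; have Fvl : F v (last z s') by rewrite symF.
have yl : y != last z s' by apply: contraNneq yN => ->; rewrite mem_last.
have := two_nbrsE (F2 vV) Fvy Fvl yl w; rewrite Fvw !inE => /esym/orP[]/eqP->.
  by rewrite eqxx !orbT.
by rewrite -in_cons mem_last !orbT.
Qed.

Definition del_edge F a b : rel T :=
  fun u v => F u v && ~~ ((u == a) && (v == b) || (u == b) && (v == a)).

(** An edge lies on a cycle, so the rest of that cycle joins its ends. *)
Lemma conn_del_edge a b : F a b -> conn (del_edge F a b) a b.
Proof.
move=> Fab; have [s [s2 Us as_ _]] := cycle_through (FV Fab).
have symD : symmetric (del_edge F a b).
  by move=> u v; rewrite /del_edge symF orbC andbC [(v == _) && _]andbC [(v == b) && _]andbC andbC.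
have [i s' rotE] := rot_to as_.
move: s2 Us; rewrite -(size_rot i) -(rot_ucycle i) rotE.
case: s' {rotE} => [|y [|z s']] //= _; rewrite /ucycle /= rcons_path.
case/andP=> /and4P[Fay Fyz Fs Fla] /and4P[aN yN zN _].
have aV := FV Fay; have Fal : F a (last z s') by rewrite symF.
have yl : y != last z s' by apply: contraNneq yN => ->; rewrite mem_last.
have delP : forall x t, path F x t -> a \notin x :: t -> path (del_edge F a b) x t.
  move=> x t; elim: t x => //= c t IH x /andP[Fxc Ft]; rewrite !inE !negb_or.
  case/and3P=> ax ac at_; rewrite {1}/del_edge Fxc (eq_sym x) (negbTE ax) /=.
  by rewrite (eq_sym c) (negbTE ac) andbF /= IH // inE negb_or ac.
have midP : conn (del_edge F a b) y (last z s').
  exists (z :: s') => //; apply: delP => //=.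
  by rewrite Fyz Fs.
have ya : y != a by apply: contraNneq aN => ->; rewrite mem_head.
have la : last z s' != a.
  by apply: contraNneq aN => <-; rewrite inE mem_last orbT.
have := two_nbrsE (F2 aV) Fay Fal yl b; rewrite Fab => /esym/orP[]/eqP bE.
  apply: (@conn_trans _ (last z s')).
    apply: conn1; rewrite /del_edge Fal eqxx /= bE (eq_sym _ y) (negbTE yl) /=.
    by rewrite (negbTE la) andbF.
  by rewrite {2}bE; apply: conn_sym symD midP.
apply: (@conn_trans _ y); last by rewrite {2}bE.
apply: conn1; rewrite /del_edge Fay eqxx /= bE (negbTE yl) /=.
by rewrite (negbTE ya) andbF.
Qed.

End Finite.

(** The cycle through u0 contains all neighbours of its vertices, hence
    everything that u0 is connected to. *)
Lemma connected_hamiltonian F e (V : pred T) (l : seq T) u0 :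
  symmetric F -> irreflexive F ->
  l =i V -> u0 \in V -> (forall u v, F u v -> u \in V) ->
  (forall u, u \in V -> two_nbrs F u) -> subrel F e ->
  (forall u, u \in V -> conn F u0 u) ->
  exists s, hamiltonian_cycle V e s.
Proof.
move=> symF irrF lV u0V FV F2 Fe F1.
have [u v|u||s [s2 /andP[Us1 Us2] us clos]] := @cycle_through F l symF irrF _ _ u0.
- by rewrite lV; apply: FV.
- by rewrite lV; apply: F2.
- by rewrite lV.
have sV v : v \in s -> exists w, F v w.
  move=> vs; have sE : cycle F s by [].
  by exists (next s v); apply: next_cycle.
exists s; split=> //.
  rewrite /ucycle Us2 andbT.
  by case: (s) Us1 => //= x t; apply: sub_path.
move=> v; apply/idP/idP => [/sV[w /FV]//|/F1].
apply: (conn_ind (P := fun v => v \in s)) => // x y; exact: clos.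
Qed.

End TwoRegular.

Lemma conn_map (T U : eqType) (F : rel T) (G : rel U) (r : T -> U) :
  (forall u v, F u v -> conn G (r u) (r v)) ->
  forall u v, conn F u v -> conn G (r u) (r v).
Proof.
move=> FG u; apply: conn_ind; last exact: conn0.
by move=> v w Gv /FG; apply: conn_trans.
Qed.

(** * Two-factors and switches *)

Definition factor (T : eqType) (e : rel T) (V : pred T) (F : rel T) : Prop :=
  [/\ symmetric F, subrel F e, forall u v, F u v -> u \in V
    & forall u, u \in V -> two_nbrs F u].

(** The family f of vertices indexed by D is matched in two ways: al describes
    edges of F to be deleted, be describes the edges that replace them. *)
Section Switch.

Variables (T I : eqType) (e F : rel T) (V : pred T).
Variables (D : seq I) (f : I -> T) (al be : I -> I).

Definition pairs (ga : I -> I) : rel T :=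
  fun u v => has (fun i => (f i == u) && (f (ga i) == v)) D.

Definition switch : rel T := fun u v => F u v && ~~ pairs al u v || pairs be u v.

Hypothesis factF : factor e V F.
Hypothesis f_inj : {in D &, injective f}.
Hypotheses (alD : {in D, forall i, al i \in D}) (beD : {in D, forall i, be i \in D}).
Hypotheses (alK : {in D, forall i, al (al i) = i}) (beK : {in D, forall i, be (be i) = i}).
Hypothesis Fal : {in D, forall i, F (f i) (f (al i))}.
Hypothesis ebe : {in D, forall i, e (f i) (f (be i))}.
Hypothesis Fbe : {in D, forall i, ~~ F (f i) (f (be i))}.

Lemma pairsE ga i v : i \in D -> pairs ga (f i) v = (v == f (ga i)).
Proof.
move=> iD; apply/hasP/eqP => [[j jD /andP[/eqP/f_inj -> // /eqP//]]|->].
by exists i => //; rewrite !eqxx.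
Qed.

Lemma pairs_notin ga u v : u \notin map f D -> pairs ga u v = false.
Proof.
move=> uD; apply/hasP => -[j jD /andP[/eqP fj _]].
by case/negP: uD; rewrite -fj map_f.
Qed.

Lemma pairs_sym ga : {in D, forall i, ga i \in D} ->
  {in D, forall i, ga (ga i) = i} -> symmetric (pairs ga).
Proof.
move=> gaD gaK u v; apply/hasP/hasP => -[j jD /andP[/eqP<- /eqP<-]];
  by exists (ga j); rewrite ?gaD ?gaK ?eqxx.
Qed.

Lemma switch_sym : symmetric switch.
Proof.
have [symF _ _ _] := factF.
by move=> u v; rewrite /switch symF (pairs_sym alD alK) (pairs_sym beD beK).
Qed.

Lemma switch_factor : factor e V switch.
Proof.
have [symF Fe FV F2] := factF.
split=> [|u v|u v|u uV]; first exact: switch_sym.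
- by case/orP=> [/andP[/Fe]//|/hasP[i iD /andP[/eqP<- /eqP<-]]]; apply: ebe.
- by case/orP=> [/andP[/FV]//|/hasP[i iD /andP[/eqP<- _]]]; apply: FV (Fal iD).
have [/mapP[i iD uE]|uD] := boolP (u \in map f D); last first.
  have [a [b [ab Fu]]] := F2 u uV; exists a, b; split=> // v.
  by rewrite /switch !pairs_notin // andbT orbF.
have [w neq_w Fw] : exists2 w, w != f (al i) & F u w.
  have [a [b [ab Fu]]] := F2 u uV.
  have [<-|aN] := eqVneq a (f (al i)); first by exists b; rewrite 1?eq_sym // Fu eqxx orbT.
  by exists a; rewrite // Fu eqxx.
exists w, (f (be i)); split.
  by apply: contraTneq Fw => ->; rewrite uE Fbe.
move=> v; rewrite /switch uE !pairsE //.
have Fai : F u (f (al i)) by rewrite uE Fal.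
rewrite -uE (two_nbrsE (F2 u uV) Fw Fai) //.
case: (eqVneq v (f (al i))) => [->|_]; last by rewrite andbT orbF.
by rewrite andbF (eq_sym _ w) (negPf neq_w).
Qed.

Lemma switch_notin u v : u \notin map f D -> switch u v = F u v.
Proof. by move=> uD; rewrite /switch !pairs_notin // andbT orbF. Qed.

Lemma switch_be i : i \in D -> switch (f i) (f (be i)).
Proof. by move=> iD; rewrite /switch (pairsE be _ iD) eqxx orbT. Qed.

(** Only the deleted edges have to be bypassed for connections to survive. *)
Lemma switch_coarser G :
  (forall u v, conn switch u v -> conn G u v) ->
  {in D, forall i, conn G (f i) (f (al i))} ->
  forall u v, conn F u v -> conn G u v.
Proof.
move=> FG alG; apply: (conn_map (r := id)) => u v Fuv.
case: (boolP (pairs al u v)) => [/hasP[i iD /andP[/eqP<- /eqP<-]]|al_uv].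
  exact: alG.
by apply/FG/conn1; rewrite /switch Fuv al_uv.
Qed.

End Switch.

(** * Dominoes *)

Local Open Scope ring_scope.

(** The line is cut into blocks of length 2r, and a column is exchanged with the
    column of its block at distance r. *)
Definition left (r : nat) (x : int) : bool := (x %% (2 * r)%N)%Z < r%:Z.
Definition partner (r : nat) (x : int) : int := if left r x then x + r%:Z else x - r%:Z.

Section Domino.

Variable r : nat.
Hypothesis r_gt0 : (0 < r)%N.

Lemma leftE (k m : int) : 0 <= m < (2 * r)%N%:Z -> left r ((2 * r)%N%:Z * k + m) = (m < r).
Proof. by move=> m_bd; rewrite /left mulrC modzMDl modz_small //; lia. Qed.

Lemma left_split x : exists k m, x = (2 * r)%N%:Z * k + m /\ 0 <= m < (2 * r)%N%:Z.
Proof.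
exists (x %/ (2 * r)%N)%Z, (x %% (2 * r)%N)%Z; split; first by rewrite mulrC -divz_eq.
by rewrite modz_ge0 ?ltz_pmod //; lia.
Qed.

Lemma leftD x : left r (x + r%:Z) = ~~ left r x.
Proof.
have [k [m [-> m_bd]]] := left_split x; rewrite leftE // -addrA.
have [mr|mr] := boolP (m < r%:Z); first by rewrite leftE; lia.
rewrite (_ : _ + _ = (2 * r)%N%:Z * (k + 1) + (m - r%:Z)); last by lia.
by rewrite leftE; lia.
Qed.

Lemma leftB x : left r (x - r%:Z) = ~~ left r x.
Proof. by rewrite -{2}(subrK r%:Z x) leftD negbK. Qed.

Lemma leftDM x (b : int) : left r (x + b * r%:Z) = left r x (+) odd `|b|%N.
Proof.
elim/int_rec: b => [|n IH|n IH]; first by rewrite mul0r addr0 addbF.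
  rewrite (_ : n.+1%:Z * r%:Z = n%:Z * r%:Z + r%:Z); last by lia.
  by rewrite addrA leftD IH /= addbN.
rewrite (_ : - n.+1%:Z * r%:Z = - n%:Z * r%:Z - r%:Z); last by lia.
by rewrite addrA leftB IH !abszN /= addbN.
Qed.

Lemma left_partner x : left r (partner r x) = ~~ left r x.
Proof. by rewrite /partner; case: ifP => lx; rewrite ?leftD ?leftB lx. Qed.

Lemma partnerK : involutive (partner r).
Proof.
move=> x; rewrite {1}/partner left_partner /partner.
by case: (left r x) => /=; lia.
Qed.

Lemma partner_dist x : `|partner r x - x|%N = r.
Proof. by rewrite /partner; case: ifP; lia. Qed.

Lemma partner_bound (n : nat) x :
  0 <= x < (2 * r * n)%N%:Z -> 0 <= partner r x < (2 * r * n)%N%:Z.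
Proof.
have [k [m [-> m_bd]]] := left_split x; rewrite /partner leftE // => x_bd.
have [k0 kn] : 0 <= k /\ k < n%:Z by split; nia.
by case: ifP => mr; nia.
Qed.

Lemma partner_mirror (n : nat) x :
  partner r ((2 * r * n)%N%:Z - 1 - x) = (2 * r * n)%N%:Z - 1 - partner r x.
Proof.
have [k [m [-> m_bd]]] := left_split x.
rewrite /partner (_ : _ - _ = (2 * r)%N%:Z * (n%:Z - k - 1) + ((2 * r)%N%:Z - 1 - m)).
  by rewrite !leftE //; [case: ifP; case: ifP; lia|lia].
by lia.
Qed.

End Domino.

(** * Strands and the relation of being mergeable *)

Section Strip.

Variables p q : nat.
Hypotheses (p_gt0 : (0 < p)%N) (q_gt0 : (0 < q)%N).

Local Notation W := (4 * p * q)%N.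
Local Notation leap := (leaper_adj p q).
Local Notation tau := (partner p).

Definition in_cols (x : int) : bool := 0 <= x < W%:Z.

Definition strip (lo hi : int) : pred cell := fun c => in_cols c.1 && (lo <= c.2 < hi).

(** In rows a <= y < b the graph F consists of strands. *)
Definition pure (F : rel cell) (a b : int) : Prop :=
  forall x y v, in_cols x -> a <= y < b ->
    F (x, y) v = (v == (tau x, y + q%:Z)) || (v == (tau x, y - q%:Z)).

(** The height h of the zone is at least 2q, so that every strand passes through
    each residue class of rows. The first row a is arbitrary: this makes merges
    independent of the position of the zone, and allows zones to be stacked. *)
Definition mergeable (L : seq (cell * cell)) : Prop :=
  (forall s s' : cell, (s, s') \in L -> in_cols s.1 && in_cols s'.1) /\
  exists2 h : nat, (2 * q <= h)%N &
  forall lo hi (F : rel cell) a, factor leap (strip lo hi) F -> pure F a (a + h%:Z) ->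
  exists F' : rel cell,
    [/\ factor leap (strip lo hi) F',
        forall u v : cell, ~~ (a <= u.2 < a + h%:Z) -> F' u v = F u v,
        forall u v : cell, conn F u v -> conn F' u v
      & forall (s s' : cell) (t t' : int), (s, s') \in L ->
          a <= s.2 + (2 * q)%N%:Z * t < a + h%:Z ->
          a <= s'.2 + (2 * q)%N%:Z * t' < a + h%:Z ->
          conn F' (s.1, s.2 + (2 * q)%N%:Z * t) (s'.1, s'.2 + (2 * q)%N%:Z * t')].

Definition merges (s s' : cell) : Prop := mergeable [:: (s, s')].

Lemma leap_irr : irreflexive leap.
Proof.
by move=> u; rewrite /leaper_adj !subrr absz0 !(eq_sym 0%N) !eqn0Ngt p_gt0 q_gt0.
Qed.

Lemma tau_in x : in_cols x -> in_cols (tau x).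
Proof.
by rewrite /in_cols -mulnA (_ : 4 * _ = 2 * p * (2 * q))%N; [apply: partner_bound|lia].
Qed.

Lemma row_in (y a : int) : exists t : int, a <= y + (2 * q)%N%:Z * t < a + (2 * q)%N%:Z.
Proof.
exists (- ((y - a) %/ (2 * q)%N)%Z); have := divz_eq (y - a) (2 * q)%N.
have := modz_ge0 (y - a) (_ : (2 * q)%N%:Z != 0); have := ltz_pmod (y - a) (_ : (2 * q)%N%:Z > 0).
by move=> /(_ ltac:(lia)) ? /(_ ltac:(lia)) ?; lia.
Qed.

Lemma iter_tau n x : iter n tau x = if odd n then tau x else x.
Proof. by elim: n => //= n ->; case: (odd n) => //=; rewrite partnerK. Qed.

Lemma iter_tauK n x : iter n tau (iter n tau x) = x.
Proof. by rewrite !iter_tau; case: (odd n); rewrite ?partnerK. Qed.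

Lemma iter_tau_in n x : in_cols x -> in_cols (iter n tau x).
Proof. by rewrite iter_tau; case: ifP => // _; apply: tau_in. Qed.

Lemma conn_zigzag (G : rel cell) x (y s : int) n :
  (forall k, (k < n)%N ->
     G (iter k tau x, y + k%:Z * s) (iter k.+1 tau x, y + k.+1%:Z * s)) ->
  conn G (x, y) (iter n tau x, y + n%:Z * s).
Proof.
elim: n => [|n IH] Gs; first by rewrite /= mul0r addr0; apply: conn0.
apply: conn_trans (IH _) (conn1 (Gs n _)) => // k kn; apply: Gs; lia.
Qed.

Lemma conn_strand (F : rel cell) a b x y n : symmetric F -> pure F a b -> in_cols x ->
  a <= y < b -> a <= y + n * q%:Z < b ->
  conn F (x, y) (iter `|n|%N tau x, y + n * q%:Z).
Proof.
move=> symF Fp xW yab ynab.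
suff up m x' y' : in_cols x' -> a <= y' < b -> a <= y' + m%:Z * q%:Z < b ->
    conn F (x', y') (iter m tau x', y' + m%:Z * q%:Z).
  case: n ynab => n ynab; first exact: up.
  rewrite NegzE abszN in ynab *.
  have -> : y + - n.+1%:Z * q%:Z = y - n.+1%:Z * q%:Z by lia.
  apply: conn_sym => //; have := up n.+1 (iter n.+1 tau x) (y - n.+1%:Z * q%:Z).
  rewrite iter_tauK subrK; apply=> //; [exact: iter_tau_in|lia].
move=> x'W y'ab; elim: m => [|m IH] mab; first by rewrite mul0r addr0; apply: conn0.
have mab' : a <= y' + m%:Z * q%:Z < b by nia.
apply: conn_trans (IH mab') _; apply: conn1.
have iW := iter_tau_in m x'W.
rewrite Fp // (_ : y' + m.+1%:Z * q%:Z = y' + m%:Z * q%:Z + q%:Z) ?eqxx //; lia.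
Qed.

Lemma conn_strand2 (F : rel cell) a b x (y y' t : int) : symmetric F -> pure F a b -> in_cols x ->
  a <= y < b -> a <= y' < b -> y' = y + (2 * q)%N%:Z * t ->
  conn F (x, y) (x, y').
Proof.
move=> symF Fp xW yab y'ab y'E; have := @conn_strand F a b x y (2 * t) symF Fp xW yab.
have -> : y + 2 * t * q%:Z = y' by lia.
by rewrite iter_tau abszM oddM /=; apply.
Qed.

Lemma pure_sub F a b a' b' : pure F a b -> a <= a' -> b' <= b -> pure F a' b'.
Proof. by move=> Fp aa' bb' x y v xW yab; apply: Fp => //; lia. Qed.

(** What happens in one zone leaves the other zones intact. *)
Lemma pure_outside F F' a b (c d : int) : pure F a b -> b <= c \/ d <= a ->
  (forall u v, ~~ (c <= u.2 < d) -> F' u v = F u v) -> pure F' a b.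
Proof. by move=> Fp bc FF x y v xW yab; rewrite FF ?Fp //=; case: bc; lia. Qed.

Lemma mergeable_nil : mergeable [::].
Proof. by split=> //; exists (2 * q)%N => // lo hi F a Ff Fp; exists F. Qed.

(** Two families of merges are performed in two zones stacked on each other. *)
Lemma mergeable_cat L1 L2 : mergeable L1 -> mergeable L2 -> mergeable (L1 ++ L2).
Proof.
move=> [L1W [h1 h1q M1]] [L2W [h2 h2q M2]]; split.
  by move=> s s'; rewrite mem_cat => /orP[/L1W|/L2W].
exists (h1 + h2)%N; first lia.
move=> lo hi F a Ff Fp.
have Fp1 : pure F a (a + h1%:Z) by apply: pure_sub Fp _ _; lia.
have [F1 [F1f F1F F1c F1L]] := M1 lo hi F a Ff Fp1.
have F1p : pure F1 (a + h1%:Z) (a + h1%:Z + h2%:Z).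
  by apply: pure_outside (pure_sub Fp _ _) _ F1F; lia.
have [F2 [F2f F2F F2c F2L]] := M2 lo hi F1 (a + h1%:Z) F1f F1p.
have symF : symmetric F by case: Ff.
have F2s : symmetric F2 by case: F2f.
have lift (L : seq (cell * cell)) (b : int) (h : nat) : (2 * q <= h)%N -> a <= b -> b + h%:Z <= a + (h1 + h2)%N%:Z ->
  (forall s s' : cell, (s, s') \in L -> in_cols s.1 && in_cols s'.1) ->
  (forall (s s' : cell) (t t' : int), (s, s') \in L ->
          b <= s.2 + (2 * q)%N%:Z * t < b + h%:Z ->
          b <= s'.2 + (2 * q)%N%:Z * t' < b + h%:Z ->
          conn F2 (s.1, s.2 + (2 * q)%N%:Z * t) (s'.1, s'.2 + (2 * q)%N%:Z * t')) ->
  forall (s s' : cell) (t t' : int), (s, s') \in L ->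
          a <= s.2 + (2 * q)%N%:Z * t < a + (h1 + h2)%N%:Z ->
          a <= s'.2 + (2 * q)%N%:Z * t' < a + (h1 + h2)%N%:Z ->
          conn F2 (s.1, s.2 + (2 * q)%N%:Z * t) (s'.1, s'.2 + (2 * q)%N%:Z * t').
  move=> hq ab bh LW Lc s s' t t' sL st st'; have /andP[sW s'W] := LW _ _ sL.
  have [t1 st1] := row_in s.2 b; have [t2 st2] := row_in s'.2 b.
  apply: conn_trans (conn_trans _ (Lc s s' t1 t2 sL _ _)) _; [| lia | lia |].
    by apply/F2c/F1c/(conn_strand2 (t := t1 - t) symF Fp) => //; lia.
  by apply/F2c/F1c/(conn_strand2 (t := t' - t2) symF Fp) => //; lia.
exists F2; split=> //.
- by move=> u v uN; rewrite F2F ?F1F //; lia.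
- by move=> u v /F1c /F2c.
move=> s s' t t'; rewrite mem_cat => /orP[sL|sL] st st'.
  apply: (lift L1 a h1 h1q (lexx a) _ L1W _ s s' t t' sL st st'); first lia.
  by move=> ? ? ? ? ? ? ?; apply/F2c/F1L.
apply: (lift L2 (a + h1%:Z) h2 h2q _ _ L2W F2L s s' t t' sL st st'); lia.
Qed.

Lemma mergeable_all L : (forall s s' : cell, (s, s') \in L -> merges s s') -> mergeable L.
Proof.
elim: L => [|[s s'] L IH] Lm; first exact: mergeable_nil.
apply: (@mergeable_cat [:: (s, s')]); first by apply: Lm; rewrite mem_head.
by apply: IH => u u' uL; apply: Lm; rewrite inE uL orbT.
Qed.

Lemma merges_in s s' : merges s s' -> in_cols s.1 /\ in_cols s'.1.
Proof. by case=> LW _; apply/andP/LW/mem_head. Qed.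

(** Nothing has to be changed to connect two cells of one strand. *)
Lemma merges_strand x (y n : int) : in_cols x ->
  merges (x, y) (iter `|n|%N tau x, y + n * q%:Z).
Proof.
move=> xW; split; first by move=> s s'; rewrite inE => /eqP[-> ->] /=; rewrite xW iter_tau_in.
exists (2 * q)%N => // lo hi F a Ff Fp; exists F; split=> // s s' t t'.
rewrite inE => /eqP[-> ->] /= yt yt'; have symF : symmetric F by case: Ff.
have := @conn_strand F _ _ x (y + (2 * q)%N%:Z * t) (2 * (t' - t) + n) symF Fp xW yt.
rewrite !iter_tau (_ : odd _ = odd `|n|%N); last by lia.
by rewrite (_ : _ + _ * q%:Z = y + n * q%:Z + (2 * q)%N%:Z * t'); [apply|lia].
Qed.

Lemma merges_refl s : in_cols s.1 -> merges s s.
Proof.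
by case: s => x y xW; have := merges_strand y 0 xW; rewrite mul0r addr0.
Qed.

Lemma merges_sym s s' : merges s s' -> merges s' s.
Proof.
case=> LW [h hq M]; split.
  by move=> ? ?; rewrite inE => /eqP[-> ->]; rewrite andbC; apply/LW/mem_head.
exists h => // lo hi F a Ff Fp; have [F' [F'f ? ? F'L]] := M lo hi F a Ff Fp.
exists F'; split=> // ? ? t t'; rewrite inE => /eqP[-> ->] st st'.
apply: conn_sym; first by case: F'f.
by apply: F'L => //; rewrite mem_head.
Qed.

Lemma merges_trans (s2 s1 s3 : cell) : merges s1 s2 -> merges s2 s3 -> merges s1 s3.
Proof.
move=> M1 M2; have [[s1W _] [_ s3W]] := (merges_in M1, merges_in M2).
case: (mergeable_cat M1 M2) => _ [h hq M]; split.
  by move=> ? ?; rewrite inE => /eqP[-> ->]; rewrite s1W.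
exists h => // lo hi F a Ff Fp; have [F' [F'f ? ? F'L]] := M lo hi F a Ff Fp.
exists F'; split=> // ? ? t t'; rewrite inE => /eqP[-> ->] st st'.
have [t2 st2] := row_in s2.2 a.
apply: (@conn_trans _ _ (s2.1, s2.2 + (2 * q)%N%:Z * t2)).
  by apply: F'L => //; [rewrite /= mem_head | lia].
by apply: F'L => //; [rewrite /= inE mem_head orbT | lia].
Qed.

Lemma merges_tau x y : in_cols x -> merges (x, y) (tau x, y + q%:Z).
Proof. by move=> xW; have := merges_strand y 1 xW; rewrite mul1r. Qed.

Lemma merges_tauN x y : in_cols x -> merges (x, y) (tau x, y - q%:Z).
Proof. by move=> xW; have := merges_strand y (-1) xW; rewrite mulN1r. Qed.

Lemma merges_2q x y (t : int) : in_cols x -> merges (x, y) (x, y + (2 * q)%N%:Z * t).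
Proof.
move=> xW; have := merges_strand y (2 * t) xW.
rewrite iter_tau abszM oddM /=.
by rewrite (_ : y + _ = y + (2 * q)%N%:Z * t) //; lia.
Qed.

(** ** Symmetries of the strip *)

Definition mirror (b : bool) (x : int) : int := if b then W%:Z - 1 - x else x.
Definition flip (b : bool) (y : int) : int := if b then - y else y.
Definition symm (b c : bool) (u : cell) : cell := (mirror b u.1, flip c u.2).

Lemma symmK b c : involutive (symm b c).
Proof.
by case: b c => [] [] [x y]; rewrite /symm /mirror /flip /= ?opprK ?subKr.
Qed.

Lemma mirror_in b x : in_cols (mirror b x) = in_cols x.
Proof. by rewrite /mirror /in_cols; case: b; lia. Qed.

Lemma tau_mirror b x : tau (mirror b x) = mirror b (tau x).
Proof.
case: b => //=; rewrite /mirror (_ : 4 * p * q = 2 * p * (2 * q))%N; last by lia.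
by rewrite partner_mirror.
Qed.

Lemma leap_symm b c u v : leap (symm b c u) (symm b c v) = leap u v.
Proof.
rewrite /leaper_adj /=.
have -> : absz (mirror b u.1 - mirror b v.1) = absz (u.1 - v.1).
  by rewrite /mirror; case: b; lia.
have -> : absz (flip c u.2 - flip c v.2) = absz (u.2 - v.2).
  by rewrite /flip; case: c; lia.
by [].
Qed.

(** As mergeable speaks of all strips and zones, a two-factor may be reflected,
    modified and reflected back. *)
Definition pull b c (F : rel cell) : rel cell := fun u v => F (symm b c u) (symm b c v).

Lemma conn_pull b c F u v : conn F u v -> conn (pull b c F) (symm b c u) (symm b c v).
Proof.
apply: (conn_map (r := symm b c)) => {}u {}v Fuv; apply: conn1.
by rewrite /pull !symmK.
Qed.

Lemma pull_factor b c F (V V' : pred cell) :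
  (forall u, V' (symm b c u) = V u) -> factor leap V' F -> factor leap V (pull b c F).
Proof.
move=> VV [symF Fl FV F2]; split.
- by move=> u v; rewrite /pull symF.
- by move=> u v /Fl; rewrite leap_symm.
- by move=> u v /FV; rewrite -topredE /= VV.
move=> u uV; have [|x [y [xy Fu]]] := F2 (symm b c u); first by rewrite -topredE /= VV.
exists (symm b c x), (symm b c y); split; first by rewrite (inj_eq (inv_inj (symmK b c))).
by move=> v; rewrite /pull Fu -!(can2_eq (symmK b c) (symmK b c)).
Qed.

Lemma pull_pure b c F a d a' d' :
  (forall y, (a' <= flip c y < d') = (a <= y < d)) ->
  pure F a' d' -> pure (pull b c F) a d.
Proof.
move=> ad Fp x y v xW yad; rewrite /pull /(symm _ _ (x, y)) /= Fp ?mirror_in ?ad //.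
rewrite !tau_mirror.
have eqS s : (symm b c v == (mirror b (tau x), s)) = (v == (tau x, flip c s)).
  rewrite (can2_eq (symmK b c) (symmK b c)) /symm /=.
  by rewrite /mirror; case: (b); rewrite ?subKr.
rewrite !eqS /flip; case: (c); rewrite ?opprD ?opprK //.
by rewrite orbC.
Qed.

Lemma merges_symm b c s s' : merges s s' -> merges (symm b c s) (symm b c s').
Proof.
case=> LW [h hq M]; split.
  by move=> ? ?; rewrite inE => /eqP[-> ->]; rewrite /= !mirror_in; apply/LW/mem_head.
exists h => // lo hi F a Ff Fp.
pose lo' : int := if c then 1 - hi else lo; pose hi' : int := if c then 1 - lo else hi.
pose a' : int := if c then 1 - (a + h%:Z) else a.
have V' u : strip lo' hi' (symm b c u) = strip lo hi u.
  by rewrite /strip /= mirror_in /flip /lo' /hi'; case: (c); lia.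
have zone' y : (a' <= flip c y < a' + h%:Z) = (a <= y < a + h%:Z).
  by rewrite /a' /flip; case: (c); lia.
have V u : strip lo hi (symm b c u) = strip lo' hi' u by rewrite -V' symmK.
have flipK y : flip c (flip c y) = y by rewrite /flip; case: (c); rewrite ?opprK.
have zone y : (a <= flip c y < a + h%:Z) = (a' <= y < a' + h%:Z) by rewrite -zone' flipK.
have [F' [F'f F'F F'c F'L]] := M lo' hi' _ a' (pull_factor V Ff) (pull_pure b zone Fp).
exists (pull b c F'); split; first exact: pull_factor F'f.
- by move=> u v uN; rewrite /pull F'F /= ?zone' // /pull !symmK.
- move=> u v /(conn_pull b c)/F'c/(conn_pull b c); by rewrite !symmK.
move=> ? ? t t'; rewrite inE => /eqP[-> ->] /= st st'.
have flipD y n : flip c y + (2 * q)%N%:Z * n = flip c (y + (2 * q)%N%:Z * flip c n).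
  by rewrite /flip; case: (c); lia.
rewrite !flipD !zone in st st' *.
have := F'L s s' (flip c t) (flip c t') (mem_head _ _) st st'.
by move=> /(conn_pull b c).
Qed.

Lemma merges_flip x y x' y' : merges (x, y) (x', y') -> merges (x, - y) (x', - y').
Proof. exact: (merges_symm false true). Qed.

Lemma merges_mirror x y x' y' :
  merges (x, y) (x', y') -> merges (W%:Z - 1 - x, y) (W%:Z - 1 - x', y').
Proof. exact: (merges_symm true false). Qed.

(** ** Switching along a shape *)

Lemma le_2q (t t' : int) : (2 * q)%N%:Z * t <= (2 * q)%N%:Z * t' -> t <= t'.
Proof. by rewrite ler_pM2l //; lia. Qed.

(** The cells of a switch. The edges i - al i belong to strands, and the leaps
    i - be i do not. Two cells may share a column, provided that they lie on
    different strands: for p = 1 and q = 2 this does happen in merges_2p. *)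
Record shape (I : eqType) (D : seq I) (f : I -> cell) (al be : I -> I) : Prop := Shape {
  shape_inj : {in D &, forall i j, (f i).1 = (f j).1 ->
                 forall n : int, (f i).2 = (f j).2 + (2 * q)%N%:Z * n -> i = j};
  shape_in : {in D, forall i, in_cols (f i).1};
  shape_al : {in D, forall i, [/\ al i \in D, al (al i) = i, (f (al i)).1 = tau (f i).1
                                & absz ((f (al i)).2 - (f i).2) = q]};
  shape_be : {in D, forall i, [/\ be i \in D, be (be i) = i, leap (f i) (f (be i))
                                & (f (be i)).1 != tau (f i).1]} }.

Section Shape.

Variables (I : eqType) (D : seq I) (f : I -> cell) (al be : I -> I).
Hypothesis shp : shape D f al be.

(** The shape is moved vertically by a multiple of the period 2q of strands. *)
Definition lift_shape (t : int) (i : I) : cell := ((f i).1, (f i).2 + (2 * q)%N%:Z * t).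

(** The deleted edge goes up from a lower cell, whose half of the strand
    therefore continues downwards. *)
Definition lower i : bool := (f i).2 < (f (al i)).2.

Lemma rows_bound : exists N : nat, {in D, forall i, (absz (f i).2 <= N)%N}.
Proof.
elim: (D) => [|i s [N IH]]; first by exists 0%N.
exists (maxn (absz (f i).2) N) => j; rewrite inE leq_max => /orP[/eqP->|/IH->].
  by rewrite leqnn.
by rewrite orbT.
Qed.

Lemma shape_strand i : i \in D -> merges (f i) (f (al i)).
Proof.
move=> iD; have iW := shape_in shp iD; have [_ _] := shape_al shp iD.
case: (f i) (f (al i)) iW => [x y] [x' y'] /= xW -> yq.
have [->|->] : y' = y + q%:Z \/ y' = y - q%:Z by lia.
  exact: merges_tau.
exact: merges_tauN.
Qed.

Section Place.

Variables (lo hi a b t : int) (F : rel cell).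
Hypotheses (factF : factor leap (strip lo hi) F) (pureF : pure F a b).
Hypothesis rows : {in D, forall i, a <= (f i).2 + (2 * q)%N%:Z * t < b}.

Let g := lift_shape t.
Let F1 := switch F D g al be.

Lemma lift_inj : {in D &, injective g}.
Proof.
by move=> i j iD jD [fij rij]; apply: (shape_inj shp iD jD fij (n := 0)); lia.
Qed.

Lemma lift_al : {in D, forall i, F (g i) (g (al i))}.
Proof.
move=> i iD; have [_ _ cE rE] := shape_al shp iD.
rewrite /g /lift_shape (pureF _ (shape_in shp iD) (rows iD)) cE !xpair_eqE !eqxx /=.
by apply/orP; lia.
Qed.

Lemma lift_be : {in D, forall i, ~~ F (g i) (g (be i))}.
Proof.
move=> i iD; have [_ _ _ /negbTE cN] := shape_be shp iD.
by rewrite /g /lift_shape (pureF _ (shape_in shp iD) (rows iD)) !xpair_eqE cN.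
Qed.

Lemma lift_factor : factor leap (strip lo hi) F1.
Proof.
apply: switch_factor => //; try by [exact: lift_inj | exact: lift_al | exact: lift_be].
- by move=> i /(shape_al shp)[].
- by move=> i /(shape_be shp)[].
- by move=> i /(shape_al shp)[].
- by move=> i /(shape_be shp)[].
move=> i /(shape_be shp)[_ _ + _].
by rewrite /leaper_adj /g /lift_shape /= opprD addrACA subrr addr0.
Qed.

Lemma lift_outside (c d : int) :
  {in D, forall i, c <= (f i).2 + (2 * q)%N%:Z * t < d} ->
  forall u v : cell, ~~ (c <= u.2 < d) -> F1 u v = F u v.
Proof.
move=> cd u v uN; apply: switch_notin; apply: contra uN => /mapP[i iD ->].
exact: cd.
Qed.

(** Only one edge of the strand of a domino is deleted, so beyond that edge the
    two halves of the strand survive. *)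
Lemma conn_half i (t1 : int) : i \in D -> a <= (f i).2 + (2 * q)%N%:Z * t1 < b ->
  (if lower i then t1 <= t else t <= t1) ->
  conn F1 (g i) ((f i).1, (f i).2 + (2 * q)%N%:Z * t1).
Proof.
move=> iD t1ab; rewrite /lower => lt1; have [aiD aaE cE rE] := shape_al shp iD.
have tab := rows iD; have iW := shape_in shp iD.
pose s := (f i).2 - (f (al i)).2.
pose n := (2 * absz (t1 - t)%R)%N.
have sE : s * n%:Z = (2 * q)%N%:Z * (t1 - t).
  by rewrite /s /n; case: ltrP lt1; nia.
have -> : ((f i).1, (f i).2 + (2 * q)%N%:Z * t1)
          = (iter n tau (g i).1, (g i).2 + n%:Z * s).
  rewrite /g iter_tau oddM /=; congr pair; lia.
apply: conn_zigzag => k kn.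
have ik_bd : a <= (g i).2 + k%:Z * s < b.
  by rewrite /g /= ; have := sE; have : 0 <= k%:Z < n%:Z by []; nia.
have sq : s = q%:Z \/ s = - q%:Z by rewrite /s; lia.
rewrite /F1 /switch; apply/orP; left; apply/andP; split.
  rewrite (pureF _ (iter_tau_in k iW) ik_bd) /= !xpair_eqE eqxx /=.
  by apply/orP; case: sq => ->; [left|right]; apply/eqP; lia.
apply/hasP => -[j jD /andP[/eqP gj /eqP gaj]].
have sN : s != 0 by lia.
have [c cE'] : exists c : int, s = c * q%:Z by case: sq => ->; [exists 1|exists (-1)]; lia.
(* j lies on the strand of i, so j is i or al i, and both are excluded because
   the zigzag leaves i away from al i. *)
have kE := odd_double_half k.
have [jE rjE] : (f j).1 = iter k tau (f i).1 /\ (f j).2 = (f i).2 + k%:Z * s.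
  by case: gj => -> rjE; split=> //; lia.
have rajE : (f (al j)).2 = (f i).2 + k.+1%:Z * s by case: gaj => _; lia.
have ks0 (m : int) : m * s = 0 -> m = 0.
  by move/eqP; rewrite mulf_eq0 (negPf sN) orbF => /eqP.
move: jE; rewrite iter_tau; case: ifP kE => k_odd kE jE.
  have cE2 : (f j).1 = (f (al i)).1 by rewrite cE.
  have rE2 : (f j).2 = (f (al i)).2 + (2 * q)%N%:Z * (((k./2)%:Z + 1) * c).
    rewrite rjE (_ : (2 * q)%N%:Z * _ = (k%:Z + 1) * s); first by rewrite /s; lia.
    by rewrite cE' (_ : k%:Z = 2 * (k./2)%:Z + 1); lia.
  have jE' := shape_inj shp jD aiD cE2 rE2.
  have := ks0 (k%:Z + 1); move: rjE; rewrite jE' /s; lia.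
have rE2 : (f j).2 = (f i).2 + (2 * q)%N%:Z * ((k./2)%:Z * c).
  by rewrite rjE cE' {1}(_ : k%:Z = 2 * (k./2)%:Z); lia.
have jE' := shape_inj shp jD iD jE rE2.
have := ks0 (k%:Z + 2); move: rajE; rewrite jE' /s; lia.
Qed.

Lemma conn_lift i (t1 : int) : i \in D -> a <= (f i).2 + (2 * q)%N%:Z * t1 < b ->
  conn F ((f i).1, (f i).2 + (2 * q)%N%:Z * t1) (g i).
Proof.
move=> iD t1ab; have [symF _ _ _] := factF.
by apply: (conn_strand2 (t := t - t1) symF pureF (shape_in shp iD) t1ab (rows iD)); lia.
Qed.

End Place.

(** The connections between half-strands that a switch and the merges in K
    provide. *)
Definition link (K : rel I) : rel I := fun i j =>
  [&& i \in D, j \in D & (j == be i) || (lower i == lower j) && K i j].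

Lemma link_sym (K : rel I) : symmetric K -> symmetric (link K).
Proof.
move=> symK i j; rewrite /link andbCA; apply: andb_id2l => jD; apply: andb_id2l => iD.
rewrite symK [lower i == _]eq_sym; congr orb.
have [_ iK _ _] := shape_be shp iD; have [_ jK _ _] := shape_be shp jD.
by apply/eqP/eqP => ->.
Qed.

(** The merges already known are carried out below and above the switch, where
    they join lower halves with lower halves and upper halves with upper halves. *)
Lemma shape_merges (K : rel I) :
  {in D &, forall i j, K i j -> merges (f i) (f j)} ->
  {in D &, forall i j, conn (link K) i j} ->
  {in D &, forall i j, merges (f i) (f j)}.
Proof.
move=> Km Kc i0 j0 i0D j0D.
pose L := [seq (f ij.1, f ij.2) | ij <- [seq ij <- [seq (i, j) | i <- D, j <- D] | K ij.1 ij.2]].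
have LE i j : i \in D -> j \in D -> K i j -> (f i, f j) \in L.
  move=> iD jD Kij; apply/mapP; exists (i, j) => //.
  by rewrite mem_filter Kij; apply/allpairsP; exists (i, j).
have [_ [h hq M]] : mergeable L.
  apply: mergeable_all => s s' /mapP[[i j]]; rewrite mem_filter /=.
  case/andP=> Kij /allpairsP[[i' j'] [/= iD jD [iE jE]]] [-> ->].
  by rewrite iE jE in Kij *; apply: Km.
have [N Nrows] := rows_bound.
split; first by move=> s s'; rewrite inE => /eqP[-> ->]; rewrite !(shape_in shp).
have [m m_def] : exists m, m = (2 * N + 2 * q + 1)%N by eexists.
exists (h + m + h)%N; first lia.
move=> lo hi F a Ff Fp.
have [t t_bd] := row_in 0 (a + h%:Z + N%:Z).
have rows : {in D, forall i, a + h%:Z <= (f i).2 + (2 * q)%N%:Z * t < a + h%:Z + m%:Z}.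
  by move=> i /Nrows; lia.
have rows' : {in D, forall i, a <= (f i).2 + (2 * q)%N%:Z * t < a + (h + m + h)%N%:Z}.
  by move=> i /rows; lia.
pose g := lift_shape t; pose F1 := switch F D g al be.
have F1f := lift_factor Ff Fp rows'.
have F1F : forall u v : cell, ~~ (a + h%:Z <= u.2 < a + h%:Z + m%:Z) -> F1 u v = F u v.
  exact: lift_outside rows.
have F1p1 : pure F1 a (a + h%:Z).
  by apply: pure_outside (pure_sub Fp _ _) _ F1F; lia.
have [F2 [F2f F2F F2c F2L]] := M lo hi F1 a F1f F1p1.
have F2p : pure F2 (a + h%:Z + m%:Z) (a + h%:Z + m%:Z + h%:Z).
  apply: pure_outside F2F; last lia.
  by apply: pure_outside (pure_sub Fp _ _) _ F1F; lia.
have [F3 [F3f F3F F3c F3L]] := M lo hi F2 _ F2f F2p.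
have F13 u v : conn F1 u v -> conn F3 u v by move/F2c/F3c.
have F3s : symmetric F3 by case: F3f.
have Kc3 i j : i \in D -> j \in D -> K i j -> lower i = lower j -> conn F3 (g i) (g j).
  move=> iD jD Kij lowE.
  have [b [ab bh bt bL]] : exists b : int, [/\ a <= b, b + h%:Z <= a + (h + m + h)%N%:Z,
      forall y t1 : int, (absz y <= N)%N -> b <= y + (2 * q)%N%:Z * t1 < b + (2 * q)%N%:Z ->
        if lower i then t1 <= t else t <= t1
    & forall (s s' : cell) (t1 t2 : int), (s, s') \in L ->
        b <= s.2 + (2 * q)%N%:Z * t1 < b + h%:Z ->
        b <= s'.2 + (2 * q)%N%:Z * t2 < b + h%:Z ->
        conn F3 (s.1, s.2 + (2 * q)%N%:Z * t1) (s'.1, s'.2 + (2 * q)%N%:Z * t2)].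
    case: (lower i); [exists a|exists (a + h%:Z + m%:Z)]; split => //; try by clear; lia.
    - by move=> y t1 yN t1b; apply: le_2q; clear -m_def hq t_bd yN t1b; lia.
    - by move=> s s' t1 t2 sL t1b t2b; apply/F3c/F2L.
    - by move=> y t1 yN t1b; apply: le_2q; clear -m_def hq t_bd yN t1b; lia.
  have [[t1 t1b] [t2 t2b]] := (row_in (f i).2 b, row_in (f j).2 b).
  have t1t := bt _ _ (Nrows i iD) t1b; have t2t := bt _ _ (Nrows j jD) t2b.
  have h1b : b <= (f i).2 + (2 * q)%N%:Z * t1 < b + h%:Z by clear -t1b hq; lia.
  have h2b : b <= (f j).2 + (2 * q)%N%:Z * t2 < b + h%:Z by clear -t2b hq; lia.
  apply: (@conn_trans _ _ ((f i).1, (f i).2 + (2 * q)%N%:Z * t1)).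
    by apply/F13/(conn_half Fp) => //; clear -h1b ab bh; lia.
  apply: (@conn_trans _ _ ((f j).1, (f j).2 + (2 * q)%N%:Z * t2)).
    by apply: bL => //; apply: LE.
  apply: conn_sym => //; apply/F13/(conn_half Fp) => //; last by rewrite -lowE.
  by clear -h2b ab bh; lia.
have gc : {in D &, forall i j, conn F3 (g i) (g j)}.
  move=> i j iD jD; apply: (conn_map (r := g)) (Kc i j iD jD) => {iD jD} k l.
  case/and3P=> kD lD /orP[/eqP->|/andP[/eqP lowE Kij]]; last exact: Kc3.
  by apply/F13/conn1/switch_be => //; apply: lift_inj.
have F3c' u v : conn F u v -> conn F3 u v.
  apply: (switch_coarser (D := D) (f := g) (al := al) (be := be)) => //.
  by move=> i iD; apply: gc => //; have [] := shape_al shp iD.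
exists F3; split=> //.
  move=> u v uN; rewrite F3F ?F2F ?F1F //; clear -uN; lia.
move=> s s' t1 t2; rewrite inE => /eqP[-> ->] t1b t2b.
apply: (@conn_trans _ _ (g i0)); first exact/F3c'/(conn_lift Ff Fp).
apply: conn_trans (gc _ _ i0D j0D) _.
by apply: conn_sym => //; apply/F3c'/(conn_lift Ff Fp).
Qed.

End Shape.

Lemma strip_enum lo hi : exists l : seq cell, l =i strip lo hi.
Proof.
have [n nE] : exists n : nat, lo < hi /\ hi = lo + n%:Z \/ hi <= lo /\ n = 0%N.
  case: (ltrP lo hi) => lohi; last by exists 0%N; right.
  by exists (absz (hi - lo)%R); left; split=> //; lia.
exists [seq (Posz x, lo + Posz y) | x <- iota 0 W, y <- iota 0 n].
move=> [x y]; apply/allpairsP/idP => [[[i j] [/=]]|].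
  by rewrite !mem_iota => iW jn [-> ->]; rewrite -topredE /= /strip /in_cols /=; lia.
rewrite -topredE /= /strip /in_cols /= => xy; exists (absz x, absz (y - lo)%R).
by rewrite /= !mem_iota; split; [lia|lia|congr pair; lia].
Qed.

Lemma factor_conn_dec lo hi (F : rel cell) u v :
  factor leap (strip lo hi) F -> u \in strip lo hi -> conn F u v \/ ~ conn F u v.
Proof.
case=> symF Fl FV F2 uV; have [l lV] := strip_enum lo hi.
have irrF : irreflexive F by move=> w; apply/negP => /Fl; rewrite leap_irr.
have [w w'|w||s [_ /andP[cs _] us clos]] := @cycle_through _ F l symF irrF _ _ u.
- by rewrite lV; apply: FV.
- by rewrite lV; apply: F2.
- by rewrite lV.
have [vs|/negP vs] := boolP (v \in s); last first.
  by right=> uv; apply: vs; move: v uv; apply: conn_ind => // ? ?; apply: clos.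
left; have [i s' rotE] := rot_to us.
move: cs vs; rewrite -(rot_cycle i) -(mem_rot i) rotE /= rcons_path => /andP[Fs _].
rewrite inE => /orP[/eqP->|vs]; first exact: conn0.
case/splitPr: vs Fs => s1 s2; rewrite -cat_rcons cat_path => /andP[Fs _].
by exists (rcons s1 v); rewrite ?last_rcons.
Qed.

(** If the two strands already lie on one cycle nothing is done; otherwise the
    switch along the four-cycle splices their two cycles into one. *)
Lemma merges_rung z y : in_cols z -> in_cols (z + p%:Z + q%:Z) ->
  left p z -> left p (z + q%:Z) -> p != q -> merges (z, y) (z + q%:Z, y + p%:Z).
Proof.
move=> zW z3W zl zql pq.
pose D := [:: (false, false); (false, true); (true, false); (true, true)].
pose f (i : bool * bool) : cell :=
  (z + i.1%:Z * q%:Z + i.2%:Z * p%:Z, y + i.1%:Z * p%:Z + i.2%:Z * q%:Z).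
pose al (i : bool * bool) := (i.1, ~~ i.2).
pose be (i : bool * bool) := (~~ i.1, i.2).
have DT i : i \in D by case: i => [[] []].
have tauz : tau z = z + p%:Z by rewrite /partner zl.
have tauzq : tau (z + q%:Z) = z + q%:Z + p%:Z by rewrite /partner zql.
have tauzp : tau (z + p%:Z) = z by rewrite -tauz partnerK.
have tauzqp : tau (z + q%:Z + p%:Z) = z + q%:Z by rewrite -tauzq partnerK.
have tau_f i : tau (f i).1 = (f (al i)).1.
  by case: i => [[] []]; rewrite /f /= ?mul1r ?mul0r ?addr0.
have shp : shape D f al be.
  split.
  - by move=> [[] []] [[] []] _ _ //; rewrite /f /= => ? ?; exfalso; lia.
  - by move=> [[] []] _; rewrite /f /=; move: zW z3W; rewrite /in_cols; lia.
  - by move=> [[] []] _; split; rewrite ?DT ?tau_f // /f /al /=; lia.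
  by move=> [[] []] _; split; rewrite ?DT ?tau_f // /al /be /leaper_adj /f /=; lia.
split; first by move=> s s'; rewrite inE => /eqP[-> ->] /=; apply/andP; move: zW z3W; rewrite /in_cols; lia.
have [N Nrows] := rows_bound D f.
exists (2 * N + 2 * q + 1)%N; first lia.
move=> lo hi F a Ff Fp.
have [t t_bd] := row_in 0 (a + N%:Z).
have rows : {in D, forall i, a <= (f i).2 + (2 * q)%N%:Z * t < a + (2 * N + 2 * q + 1)%N%:Z}.
  by move=> i /Nrows; lia.
pose g := lift_shape f t; pose F1 := switch F D g al be.
have F1f : factor leap (strip lo hi) F1 := lift_factor shp Ff Fp rows.
have [symF Fl FV F2] := Ff; have symF1 : symmetric F1 by case: F1f.
have gal i : F (g i) (g (al i)) by apply: (lift_al shp Fp rows (DT i)).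
have gbe i : conn F1 (g i) (g (be i)) by apply: conn1; apply: switch_be; [apply: (lift_inj shp)|apply: DT].
have gV i : g i \in strip lo hi := FV _ _ (gal i).
have joined F' : (forall u v : cell, conn F u v -> conn F' u v) -> symmetric F' ->
    conn F' (g (false, false)) (g (true, false)) ->
    forall (s s' : cell) (t1 t2 : int), (s, s') \in [:: ((z, y), (z + q%:Z, y + p%:Z))] ->
      a <= s.2 + (2 * q)%N%:Z * t1 < a + (2 * N + 2 * q + 1)%N%:Z ->
      a <= s'.2 + (2 * q)%N%:Z * t2 < a + (2 * N + 2 * q + 1)%N%:Z ->
      conn F' (s.1, s.2 + (2 * q)%N%:Z * t1) (s'.1, s'.2 + (2 * q)%N%:Z * t2).
  move=> FF' symF' gg s s' t1 t2; rewrite inE => /eqP[-> ->] t1b t2b.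
  have ff0 : f (false, false) = (z, y) by rewrite /f /= !mul0r !addr0.
  have ff1 : f (true, false) = (z + q%:Z, y + p%:Z) by rewrite /f /= !mul0r !mul1r !addr0.
  rewrite -ff0 -ff1 in t1b t2b *.
  apply: conn_trans (conn_trans gg _); first exact/FF'/(conn_lift shp Ff Fp).
  by apply: conn_sym => //; apply/FF'/(conn_lift shp Ff Fp).
have [gg|gNg] := factor_conn_dec (g (true, false)) Ff (gV (false, false)).
  by exists F; split=> //; apply: joined.
have [l lV] := strip_enum lo hi.
have irrF : irreflexive F by move=> w; apply/negP => /Fl; rewrite leap_irr.
have Fl_V u v : F u v -> u \in l by rewrite lV; apply: FV.
have F2l u : u \in l -> two_nbrs F u by rewrite lV; apply: F2.
have gNi (b : bool) : ~ conn F (g (false, false)) (g (true, b)).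
  case: b => // gg; apply: gNg; apply: conn_trans gg _.
  by apply: conn1; rewrite symF; apply: gal.
(* The cycle of the first deleted edge, without this edge, avoids the second
   one, so it joins the two ends also after the switch. *)
have g01 : conn F1 (g (false, false)) (g (false, true)).
  have [] // : conn F (g (false, false)) (g (false, true)) /\ conn F1 (g (false, false)) (g (false, true)).
  have := conn_del_edge symF irrF Fl_V F2l (gal (false, false)).
  apply: (conn_ind (P := fun v => conn F (g (false, false)) v /\ conn F1 (g (false, false)) v));
    last by split; apply: conn0.
  move=> v w [Fv F1v] /andP[Fvw delN].
  have Fw := conn_trans Fv (conn1 Fvw); split=> //.
  apply: conn_trans F1v _; apply: conn1; rewrite /F1 /switch Fvw andTb.
  apply/orP; left; apply/hasP => -[[[] b] _ /andP[/eqP gv /eqP gw]].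
    by apply: (gNi b); rewrite gv.
  by move: delN; rewrite -gv -gw /al; case: b {gv gw}; rewrite /= !eqxx ?orbT.
have gg1 : conn F1 (g (true, false)) (g (true, true)).
  by apply: conn_trans (gbe (true, false)) (conn_trans g01 (gbe (false, true))).
have FF1 u v : conn F u v -> conn F1 u v.
  apply: (switch_coarser (D := D) (f := g) (al := al) (be := be)) => //.
  by move=> [[] []] _ //=; apply: conn_sym.
exists F1; split=> //; last by apply: joined => //; apply: gbe.
by move=> u v uN; rewrite /F1 (lift_outside _ _ _ rows).
Qed.

(** ** Merging beyond the reach of a single rung *)

Hypotheses (lt_pq : (p < q)%N) (odd_pq : odd (p + q)) (co_pq : coprime p q).

Lemma pq_split (a b : int) : a * q%:Z = b * p%:Z -> exists c : int, a = c * p%:Z /\ b = c * q%:Z.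
Proof.
move=> ab; have p_dvd_a : (p %| absz a)%N.
  by rewrite -(@Gauss_dvdl _ _ q) //; apply/dvdnP; exists (absz b); lia.
case/dvdnP: p_dvd_a => n aE.
by case: a aE ab => a aE ab; [exists n%:Z|exists (- n%:Z)]; nia.
Qed.

(** An eight-cycle through two pairs of dominoes: the rungs of each pair are
    known, and the switch links the two pairs. The index (a, (c, d)) stands for
    the column z + aq + (2c + d)p. *)
Lemma merges_2p z y : 0 <= z -> z + q%:Z + (3 * p)%N%:Z < W%:Z ->
  left p z -> left p (z + q%:Z) -> merges (z, y) (z + (2 * p)%N%:Z, y).
Proof.
move=> z0 zW zl zql.
pose I := (bool * (bool * bool))%type.
pose D : seq I := [seq (a, cd) | a <- [:: false; true],
  cd <- [:: (false, false); (false, true); (true, false); (true, true)]].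
pose Y (i : I) : int := let: (a, (c, d)) := i in
  if a then p%:Z + (if c == d then (if c then q%:Z else 0) else (if c then 0 else - q%:Z))
  else if d then q%:Z else if c then (2 * q)%N%:Z else 0.
pose f (i : I) : cell :=
  (z + i.1%:Z * q%:Z + (2 * i.2.1 + i.2.2)%N%:Z * p%:Z, y + Y i).
pose al (i : I) : I := (i.1, (i.2.1, ~~ i.2.2)).
pose be (i : I) : I := let: (a, (c, d)) := i in
  if c == d then (~~ a, (c, d)) else (a, (~~ c, ~~ d)).
have DT i : i \in D by case: i => [[] [[] []]].
have left_f i : left p (f i).1 = ~~ i.2.2.
  rewrite /f /= leftDM //; case: i => [a [c d]] /=; rewrite oddD oddM /=.
  by case: a => /=; rewrite ?mul1r ?mul0r ?addr0 ?zl ?zql /=; case: d.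
have tau_f i : (f (al i)).1 = tau (f i).1.
  by rewrite /partner left_f; case: i => [a [c []]]; rewrite /f /=; lia.
have fW i : in_cols (f i).1.
  by move: zW; rewrite /in_cols /f; case: i => [[] [[] []]] /=; lia.
have shp : shape D f al be.
  split=> //.
  - move=> i j _ _; rewrite /f /= => colE n rowE.
    have [|c [c1 c2]] := @pq_split (i.1%:Z - j.1%:Z)
      ((2 * j.2.1 + j.2.2)%N%:Z - (2 * i.2.1 + i.2.2)%N%:Z).
      move: colE; move: i.1%:Z j.1%:Z (2 * j.2.1 + j.2.2)%N%:Z (2 * i.2.1 + i.2.2)%N%:Z.
      by clear=> *; lia.
    have [c0|cN] := eqVneq c 0.
      by rewrite c0 in c1 c2; clear -c1 c2; case: i j c1 c2 => [[] [[] []]] [[] [[] []]] //= ? ?; exfalso; lia.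
    have A_bd : -1 <= i.1%:Z - j.1%:Z <= 1 by clear; case: (i.1) (j.1) => [] [].
    have B_bd : (2 * j.2.1 + j.2.2)%N%:Z - (2 * i.2.1 + i.2.2)%N%:Z < 4.
      by clear; case: (i.2.1) (i.2.2) (j.2.1) (j.2.2) => [] [] [] [].
    have B_bd' : -4 < (2 * j.2.1 + j.2.2)%N%:Z - (2 * i.2.1 + i.2.2)%N%:Z.
      by clear; case: (i.2.1) (i.2.2) (j.2.1) (j.2.2) => [] [] [] [].
    (* Two columns coincide only for the (1, 2)-leaper, and then the rows differ
       modulo 2q. *)
    have cE : c = 1 \/ c = -1.
      by move: A_bd; rewrite c1; clear -cN p_gt0; nia.
    have [p1 q4] : p = 1%N /\ (q < 4)%N.
      by move: A_bd B_bd B_bd'; rewrite c1 c2; clear -cE p_gt0; case: cE => ->; lia.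
    have q2 : q = 2%N by move: odd_pq lt_pq q4; rewrite p1; clear; case: (q) => [|[|[|[|]]]].
    move: c1 c2 rowE; rewrite /Y p1 q2; clear -cN.
    by case: i j => [[] [[] []]] [[] [[] []]] //= ? ? ?; exfalso; lia.
  - move=> i _; split; rewrite ?DT //; first by case: i => [a [c []]].
    by rewrite /f /Y; case: i => [[] [[] []]] /=; lia.
  move=> i _; split; rewrite ?DT //; first by case: i => [[] [[] []]].
    by rewrite /f /Y /leaper_adj; case: i => [[] [[] []]] /=; lia.
  by rewrite /partner left_f /f; case: i => [[] [[] []]] /=; lia.
have lowE i : lower f al i = ~~ (i.1 (+) i.2.1 (+) i.2.2).
  by rewrite /lower /f /Y; case: i => [[] [[] []]] /=; lia.
pose K : rel I := fun i j => i.2.1 == j.2.1.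
have linkE i j : link D f al be K i j =
    (j == be i) || (~~ (i.1 (+) i.2.1 (+) i.2.2) == ~~ (j.1 (+) j.2.1 (+) j.2.2)) && K i j.
  by rewrite /link !DT !lowE.
pose i0 : I := (false, (false, false)).
have base i : merges (f (false, (i.2.1, false))) (f i).
  have strand k : merges (f k) (f (al k)) := shape_strand shp (DT k).
  have rung c : merges (f (false, (c, false))) (f (true, (c, false))).
    pose x := z + (2 * c)%N%:Z * p%:Z; pose r : int := if c then (2 * q)%N%:Z else 0.
    have -> : f (false, (c, false)) = (x, y + r) by rewrite /f /x /=; congr pair; lia.
    have -> : f (true, (c, false)) = (x + q%:Z, y + p%:Z).
      by rewrite /f /x; clear; case: c => /=; congr pair; lia.
    have xl : left p x by rewrite leftDM // zl oddM.
    have xql : left p (x + q%:Z) by rewrite addrAC leftDM // zql oddM.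
    have [xW xqW xpqW] : [/\ in_cols x, in_cols (x + q%:Z) & in_cols (x + p%:Z + q%:Z)].
      by move: z0 zW; rewrite /in_cols /x; clear; case: c => /=; split; lia.
    apply: merges_trans (merges_rung _ xW xpqW xl xql _) _; first by clear -lt_pq; lia.
    have := merges_2q (y + r + p%:Z) (if c then -1 else 0) xqW.
    have -> // : y + r + p%:Z + (2 * q)%N%:Z * (if c then -1 else 0) = y + p%:Z.
    by rewrite /r; clear; case: c; lia.
  case: i => [[] [c []]] /=.
  - exact: merges_trans (rung c) (strand _).
  - exact: rung.
  - exact: strand.
  - exact: merges_refl (fW _).
have sym_link : symmetric (link D f al be K).
  by apply: (link_sym shp) => i j; rewrite /K eq_sym.
have link_i0 i : conn (link D f al be K) i i0.
  have edge k l : link D f al be K k l -> conn (link D f al be K) l i0 ->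
    conn (link D f al be K) k i0 by move=> kl; apply: conn_trans (conn1 kl).
  have c000 : conn (link D f al be K) i0 i0 by apply: conn0.
  have c100 : conn (link D f al be K) (true, (false, false)) i0 by apply: (edge _ i0) => //; rewrite linkE.
  have c001 : conn (link D f al be K) (false, (false, true)) i0 by apply: (edge _ (true, (false, false))) => //; rewrite linkE.
  have c101 : conn (link D f al be K) (true, (false, true)) i0 by apply: (edge _ i0) => //; rewrite linkE.
  have c010 : conn (link D f al be K) (false, (true, false)) i0 by apply: (edge _ (false, (false, true))) => //; rewrite linkE.
  have c110 : conn (link D f al be K) (true, (true, false)) i0 by apply: (edge _ (true, (false, true))) => //; rewrite linkE.
  have c111 : conn (link D f al be K) (true, (true, true)) i0 by apply: (edge _ (false, (true, false))) => //; rewrite linkE.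
  have c011 : conn (link D f al be K) (false, (true, true)) i0 by apply: (edge _ (true, (true, true))) => //; rewrite linkE.
  by case: i => [[] [[] []]].
have M : merges (f i0) (f (false, (true, false))).
  apply: (shape_merges shp (K := K)) => // [i j _ _ /eqP ij|i j _ _].
    by apply: merges_trans (merges_sym (base i)) _; rewrite ij; apply: base.
  by apply: conn_trans (link_i0 i) _; apply: conn_sym.
have fW1 := fW (false, (true, false)).
have -> : (z, y) = f i0 by rewrite /f /=; congr pair; lia.
have -> : (z + (2 * p)%N%:Z, y) = ((f (false, (true, false))).1,
    (f (false, (true, false))).2 + (2 * q)%N%:Z * -1).
  by rewrite /f /=; congr pair; lia.
apply: merges_trans M _.
case: (f _) fW1 => x r /= xW; exact: merges_2q.
Qed.

(** ** The triangle switch *)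

(** The index (a, b) stands for the column z + aq + bp. The dominoes of the
    triangle are two on each level 1 <= a <= j, one at the apex (0, 0), and j + 1
    on the base a = j + 1. A step from level a to level a + 1 by q changes the
    side of a column for a < j, and keeps it for a = j; hence the left cells are
    those with b = a modulo 2 for a <= j, and b = j modulo 2 on the base. *)
Section Triangle.

Variable j : nat.
Local Notation idx := (int * int)%type.

Definition tri_in (i : idx) : bool :=
  (0 <= i.1 <= j%:Z) && [|| i.2 == - i.1, i.2 == 1 - i.1, i.2 == i.1 | i.2 == i.1 + 1]
  || (i.1 == j.+1%:Z) && (- j%:Z <= i.2 <= j.+1%:Z).

Definition tri : seq idx := [seq i <- [seq (a%:Z, b%:Z - j%:Z) |
  a <- iota 0 j.+2, b <- iota 0 (2 * j.+1)] | tri_in i].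

(** The side of a column of the triangle within its domino, read off its index. *)
Definition tri_left (i : idx) : bool := ~~ odd (absz (Num.min i.1 j%:Z + i.2)).

(** Two dominoes of consecutive levels are linked by a leap with horizontal step
    q. The rows alternate between two patterns, such that the vertical part of
    that leap is p. *)
Definition tri_row (i : idx) : int :=
  if i.1 == j.+1%:Z then (if tri_left i then p%:Z else p%:Z + q%:Z)
  else if odd (absz (j%:Z - i.1)) then (if tri_left i then p%:Z + q%:Z else p%:Z)
  else if tri_left i then 0 else q%:Z.

Definition tri_al (i : idx) : idx := (i.1, if tri_left i then i.2 + 1 else i.2 - 1).

(** Along the legs the links go from level to level; on the base they join
    neighbouring dominoes. *)
Definition tri_be (i : idx) : idx :=
  if i.1 == j.+1%:Z then
    if (i.2 == - j%:Z) || (i.2 == j.+1%:Z) then (j%:Z, i.2)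
    else (i.1, if tri_left i then i.2 - 1 else i.2 + 1)
  else (if (i.2 == - i.1) || (i.2 == i.1 + 1) then i.1 + 1 else i.1 - 1, i.2).

Lemma mem_tri i : (i \in tri) = tri_in i.
Proof.
rewrite mem_filter andb_idr // => tri_i; apply/allpairsP; exists (absz i.1, absz (i.2 + j%:Z)).
move: tri_i; rewrite /tri_in !mem_iota; case: i => a b /= ab.
by split; [lia|lia|congr pair; lia].
Qed.

Variant tri_spec : idx -> Prop :=
| TriLL (a : int) of 0 <= a <= j%:Z : tri_spec (a, - a)
| TriLR (a : int) of 0 <= a <= j%:Z : tri_spec (a, 1 - a)
| TriRL (a : int) of 0 <= a <= j%:Z : tri_spec (a, a)
| TriRR (a : int) of 0 <= a <= j%:Z : tri_spec (a, a + 1)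
| TriB (b : int) of - j%:Z <= b <= j.+1%:Z : tri_spec (j.+1%:Z, b).

Lemma triP i : i \in tri -> tri_spec i.
Proof.
rewrite mem_tri /tri_in; case: i => a b /=.
case/orP=> [/andP[aj /or4P[]/eqP->]|/andP[/eqP-> bj]]; [exact: TriLL|exact: TriLR|exact: TriRL|exact: TriRR|exact: TriB].
Qed.

Lemma tri_left_al i : tri_left (tri_al i) = ~~ tri_left i.
Proof. by rewrite /tri_left /tri_al; case: i => a b /=; case: ifP; lia. Qed.

Lemma tri_al_in i : i \in tri -> tri_al i \in tri.
Proof.
move=> it; rewrite mem_tri; case/triP: it => [a aj|a aj|a aj|a aj|b bj];
  rewrite /tri_in /tri_al /tri_left /=; case: ifP; lia.
Qed.

Lemma tri_alK i : tri_al (tri_al i) = i.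
Proof.
rewrite {1}/tri_al tri_left_al /tri_al; case: i => a b /=.
by case: (tri_left _) => /=; congr pair; lia.
Qed.

Lemma tri_be_in i : i \in tri -> tri_be i \in tri.
Proof.
move=> it; rewrite mem_tri; case/triP: it => [a aj|a aj|a aj|a aj|b bj];
  rewrite /tri_in /tri_be /tri_left /=; do ?[case: ifP => ? /=]; lia.
Qed.

Lemma tri_beK i : i \in tri -> tri_be (tri_be i) = i.
Proof.
move=> it; move Dk: (tri_be i) => k; move: Dk.
case/triP: it => [a aj|a aj|a aj|a aj|b bj];
  rewrite {1}/tri_be /tri_left /=; do ?[case: ifP => ? /=] => <-;
  rewrite /tri_be /tri_left /=; do ?[case: ifP => ? /=]; apply/eqP; rewrite xpair_eqE; lia.
Qed.

Lemma tri_row_up (a b : int) : 0 <= a <= j%:Z ->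
  absz (tri_row (a + 1, b) - tri_row (a, b))%R = p.
Proof.
move=> aj; rewrite /tri_row /= (_ : (a == j.+1%:Z) = false); last by lia.
case: (eqVneq (a + 1) j.+1%:Z) => [aE|aN].
  have aE' : a = Posz j by lia.
  rewrite aE' subrr /= (_ : tri_left (_, b) = tri_left (j%:Z, b)); last by rewrite /tri_left /=; lia.
  by case: ifP => _; lia.
rewrite (_ : odd (absz (j%:Z - (a + 1))%R) = ~~ odd (absz (j%:Z - a))); last by lia.
rewrite (_ : tri_left (a + 1, b) = ~~ tri_left (a, b)); last by rewrite /tri_left /=; lia.
by case: (odd _); case: (tri_left _) => /=; lia.
Qed.

Lemma tri_be_step (i : idx) : i \in tri ->
  let k := tri_be i in
  [/\ k.2 = i.2, absz (k.1 - i.1)%R = 1%N & absz (tri_row k - tri_row i)%R = p] \/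
  [/\ k.1 = i.1, k.2 = (if tri_left i then i.2 - 1 else i.2 + 1)
    & absz (tri_row k - tri_row i)%R = q].
Proof.
move=> it /=.
have up (a b : int) : 0 <= a <= j%:Z -> tri_be (a, b) = (a + 1, b) ->
    let k := tri_be (a, b) in
    [/\ k.2 = b, absz (k.1 - a)%R = 1%N & absz (tri_row k - tri_row (a, b))%R = p].
  by move=> aj -> /=; rewrite tri_row_up //; split=> //; lia.
have down (a b : int) : 0 <= a - 1 <= j%:Z -> tri_be (a, b) = (a - 1, b) ->
    let k := tri_be (a, b) in
    [/\ k.2 = b, absz (k.1 - a)%R = 1%N & absz (tri_row k - tri_row (a, b))%R = p].
  move=> aj -> /=; have E := tri_row_up b aj; rewrite subrK in E.
  by split=> //; [lia | rewrite distnC].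
case/triP: it => [a aj|a aj|a aj|a aj|b bj].
- left; apply: up => //; rewrite /tri_be /= eqxx; case: ifP => //; lia.
- left; have [a0|aN] := eqVneq a 0.
    by apply: up => //; rewrite /tri_be a0.
  apply: down; first lia.
  by rewrite /tri_be /=; do ?[case: ifP => ?]; congr pair; lia.
- left; have [a0|aN] := eqVneq a 0.
    by apply: up => //; rewrite /tri_be a0.
  apply: down; first lia.
  by rewrite /tri_be /=; do ?[case: ifP => ?]; congr pair; lia.
- left; apply: up => //; rewrite /tri_be /= eqxx orbT; case: ifP => //; lia.
have [b_end|b_in] := boolP ((b == - j%:Z) || (b == j.+1%:Z)).
  left; apply: down; first lia.
  by rewrite /tri_be /= eqxx b_end; congr pair; lia.
right; rewrite {1 2 3}/tri_be /= eqxx (negPf b_in) /=; split=> //.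
rewrite /tri_row /= eqxx.
set b' := (if _ then b - 1 else _).
have -> : tri_left (j.+1%:Z, b') = ~~ tri_left (j.+1%:Z, b).
  by rewrite /b' /tri_left /=; case: ifP; lia.
by case: (tri_left _) => /=; lia.
Qed.


Variables z y : int.
Hypotheses (j_gt0 : (0 < j)%N) (j_ltp : (j < p)%N).
Hypotheses (z0 : 0 <= z) (zW : z + j.+1%:Z * (p%:Z + q%:Z) < W%:Z).
Hypothesis zleft : forall a : int, 0 <= a <= j%:Z -> left p (z + a * q%:Z) = ~~ odd (absz a).
Hypothesis zleft1 : left p (z + j.+1%:Z * q%:Z) = ~~ odd j.

Definition tri_cell (i : idx) : cell := (z + i.1 * q%:Z + i.2 * p%:Z, y + tri_row i).

Lemma left_tri i : i \in tri -> left p (tri_cell i).1 = tri_left i.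
Proof.
have body a b : 0 <= a <= j%:Z -> left p (z + a * q%:Z + b * p%:Z) = tri_left (a, b).
  by move=> aj; rewrite leftDM // zleft // /tri_left /=; lia.
case/triP => [a aj|a aj|a aj|a aj|b bj]; rewrite /tri_cell /=; try exact: body.
by rewrite leftDM // zleft1 /tri_left /=; lia.
Qed.

(** A coincidence of columns means aq + bp = 0 for differences (a, b) of indices,
    hence (a, b) is a multiple of (p, -q), for which the triangle is too small:
    a is at most j + 1 <= p, and b is less than q if a is j + 1. *)
Lemma tri_inj (i k : idx) : i \in tri -> k \in tri ->
  (tri_cell i).1 = (tri_cell k).1 -> i = k.
Proof.
move=> it kt /= colE.
have [|c [c1 c2]] := @pq_split (i.1 - k.1) (k.2 - i.2); first by lia.
have c_bd : - (j%:Z + 1) <= c * p%:Z <= j%:Z + 1.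
  by rewrite -c1; case: (triP it) => * /=; case: (triP kt) => * /=; lia.
have : c = 0 \/ c = 1 \/ c = -1 by clear -j_ltp c_bd p_gt0; nia.
case=> [c0|cN1].
  move: c1 c2; rewrite c0 !mul0r; case: (i) (k) => a b [a' b'] /= ? ?; congr pair; lia.
exfalso; case: cN1 c1 c2 => ->; rewrite ?mul1r ?mulN1r.
  by case: (triP it) => ? ?; case: (triP kt) => ? ? /=; lia.
by case: (triP it) => ? ?; case: (triP kt) => ? ? /=; lia.
Qed.

Lemma tri_in_cols (i : idx) : i \in tri -> in_cols (tri_cell i).1.
Proof.
move=> /triP it; rewrite /in_cols /tri_cell /=.
have [a_bd b_bd] : 0 <= i.1 <= j.+1%:Z /\ - i.1 <= i.2 <= j.+1%:Z.
  by case: it => * /=; lia.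
have m1 : 0 <= i.1 * (q%:Z - p%:Z) by apply: mulr_ge0; lia.
have m2 : 0 <= (i.1 + i.2) * p%:Z by apply: mulr_ge0; lia.
have m3 : 0 <= (j.+1%:Z - i.1) * q%:Z by apply: mulr_ge0; lia.
have m4 : 0 <= (j.+1%:Z - i.2) * p%:Z by apply: mulr_ge0; lia.
clear -m1 m2 m3 m4 z0 zW. lia.
Qed.

Lemma tri_alP (i : idx) : i \in tri ->
  [/\ tri_al i \in tri, tri_al (tri_al i) = i,
      (tri_cell (tri_al i)).1 = tau (tri_cell i).1
    & absz ((tri_cell (tri_al i)).2 - (tri_cell i).2) = q].
Proof.
move=> it; split.
- exact: tri_al_in.
- exact: tri_alK.
- by rewrite /partner left_tri // /tri_al /=; case: ifP => _; lia.
rewrite /tri_cell /= /tri_row tri_left_al /=.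
by case: (tri_left i); do ?[case: ifP => _ /=]; lia.
Qed.

Lemma tri_beP (i : idx) : i \in tri ->
  [/\ tri_be i \in tri, tri_be (tri_be i) = i, leap (tri_cell i) (tri_cell (tri_be i))
    & (tri_cell (tri_be i)).1 != tau (tri_cell i).1].
Proof.
move=> it; split.
- exact: tri_be_in.
- exact: tri_beK.
- case: (tri_be_step it); rewrite /leaper_adj /tri_cell /=; case: (i) (tri_be i) => a b [a' b'] /=.
    case=> -> aE rE; have aE' : a' = a + 1 \/ a' = a - 1 by lia.
    by case: aE' rE => -> rE; lia.
  by case=> -> -> rE; case: (tri_left _) rE => /= rE; lia.
case: (tri_alP it) => _ _ <- _; case: (tri_be_step it); rewrite /tri_cell /tri_al /=.
  case=> -> aE _; have aE' : (tri_be i).1 = i.1 + 1 \/ (tri_be i).1 = i.1 - 1 by lia.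
  by case: aE' => ->; case: (tri_left i); lia.
by case=> -> -> _; case: (tri_left i); lia.
Qed.

Lemma tri_shape : shape tri tri_cell tri_al tri_be.
Proof.
split; [|exact: tri_in_cols|exact: tri_alP|exact: tri_beP].
by move=> i k it kt colE _ _; apply: tri_inj.
Qed.


(** The hypotheses come from the induction on the level: along the legs, the
    columns have lower level than the apex. *)
Section Known.

Hypothesis legs : forall a b y1 y2 : int, 0 < a <= j%:Z -> b = - a \/ b = a + 1 ->
  absz (y2 - y1) = p ->
  merges (z + a * q%:Z + b * p%:Z, y1) (z + (a + 1) * q%:Z + b * p%:Z, y2).
Hypothesis base : forall b y1 : int, - j%:Z <= b <= j%:Z - 2 -> ~~ odd (absz (j%:Z + b)) ->
  merges (z + j.+1%:Z * q%:Z + b * p%:Z, y1) (z + j.+1%:Z * q%:Z + (b + 2) * p%:Z, y1).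

Let top : idx := (j.+1%:Z, - j%:Z).

Lemma tri_base (b : int) : - j%:Z <= b <= j.+1%:Z -> merges (tri_cell (j.+1%:Z, b)) (tri_cell top).
Proof.
have inB (c : int) : - j%:Z <= c <= j.+1%:Z -> (j.+1%:Z, c) \in tri.
  by rewrite mem_tri /tri_in /=; lia.
have cellE (c : int) : ~~ odd (absz (j%:Z + c)) ->
    tri_cell (j.+1%:Z, c) = (z + j.+1%:Z * q%:Z + c * p%:Z, y + p%:Z).
  move=> c_even; rewrite /tri_cell /tri_row (_ : tri_left _ = true) /= ?eqxx //.
  by rewrite /tri_left /=; lia.
have even_base (n : nat) : (n <= j)%N -> merges (tri_cell (j.+1%:Z, (2 * n)%N%:Z - j%:Z)) (tri_cell top).
  elim: n => [|n IH] nj; first by rewrite muln0 sub0r; apply/merges_refl/tri_in_cols/inB; lia.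
  apply: merges_trans (merges_sym _) (IH _); last by lia.
  rewrite (_ : (2 * n.+1)%N%:Z - j%:Z = (2 * n)%N%:Z - j%:Z + 2); last by lia.
  by rewrite !cellE; [apply: base|..]; lia.
move=> bj; have [b_odd|b_even] := boolP (odd (absz (j%:Z + b))).
  apply: merges_trans (shape_strand tri_shape (inB _ bj)) _.
  have := even_base (absz (j%:Z + b)%R)./2.
  rewrite /tri_al (_ : tri_left _ = false); last by rewrite /tri_left /=; lia.
  by rewrite (_ : (2 * _)%N%:Z - _ = b - 1); [apply; lia|lia].
have := even_base (absz (j%:Z + b)%R)./2.
by rewrite (_ : (2 * _)%N%:Z - _ = b); [apply; lia|lia].
Qed.

Lemma tri_up (a b : int) : 0 < a <= j%:Z -> b = - a \/ b = a + 1 ->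
  merges (tri_cell (a, b)) (tri_cell (a + 1, b)).
Proof.
move=> aj bE; apply: legs => //; rewrite -(tri_row_up b (a := a)); [congr absz|]; lia.
Qed.

Lemma tri_known (i : idx) : i \in tri -> 0 < i.1 -> merges (tri_cell i) (tri_cell top).
Proof.
have [n] := ubnP (absz (j.+1%:Z - i.1)); elim: n i => // n IH i lt_n it i_gt0.
have step (b : int) : 0 < i.1 <= j%:Z -> b = - i.1 \/ b = i.1 + 1 -> merges (tri_cell (i.1, b)) (tri_cell top).
  move=> aj bE; apply: merges_trans (tri_up aj bE) (IH _ _ _ _) => /=; try lia.
  by rewrite mem_tri /tri_in /=; lia.
have [it' _ _ _] := tri_alP it; have Ma := shape_strand tri_shape it.
move: i_gt0 step lt_n Ma; case/triP: (it) => [a aj|a aj|a aj|a aj|b bj] /= i_gt0 step lt_n Ma.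
- by apply: step; [lia|left].
- apply: merges_trans Ma _; rewrite /tri_al /= (_ : tri_left _ = false); last by rewrite /tri_left /=; lia.
  by apply: step; [lia|left; lia].
- apply: merges_trans Ma _; rewrite /tri_al /= (_ : tri_left _ = true); last by rewrite /tri_left /=; lia.
  by apply: step; [lia|right; lia].
- by apply: step; [lia|right].
exact: tri_base.
Qed.

(** Every strand that the triangle meets away from its apex is already merged with
    every other one, so its upper halves hang together, and so do its lower
    halves; the base links both classes and the apex is linked to them. *)
Lemma tri_merges (i k : idx) : i \in tri -> k \in tri -> merges (tri_cell i) (tri_cell k).
Proof.
pose K : rel idx := fun i k => (0 < i.1) && (0 < k.1).
apply: (shape_merges tri_shape (K := K)) => [{}i {}k it kt /andP[i0 k0]|].
  exact: merges_trans (tri_known it i0) (merges_sym (tri_known kt k0)).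
have sym_link : symmetric (link tri tri_cell tri_al tri_be K).
  by apply: (link_sym tri_shape) => {}i {}k; rewrite /K andbC.
suff to_top l : l \in tri -> conn (link tri tri_cell tri_al tri_be K) l top.
  by move=> l m lt mt; apply: conn_trans (to_top l lt) (conn_sym sym_link (to_top m mt)).
have top_in : top \in tri by rewrite mem_tri /tri_in /top /=; lia.
have lower_top : lower tri_cell tri_al top.
  rewrite /lower /tri_cell /tri_al /tri_row /top /= eqxx.
  rewrite (_ : tri_left (_, - _) = true); last by rewrite /tri_left /=; lia.
  by rewrite (_ : tri_left _ = false) ?/tri_left /=; lia.
have above l0 : l0 \in tri -> 0 < l0.1 -> conn (link tri tri_cell tri_al tri_be K) l0 top.
  move=> lt l0_gt0; have [low|nlow] := boolP (lower tri_cell tri_al l0).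
    by apply: conn1; rewrite /link lt top_in low lower_top /K l0_gt0 orbT.
  pose m : idx := (j.+1%:Z, 1 - j%:Z); pose m' : idx := (j.+1%:Z, 2 - j%:Z).
  have mt : m \in tri by rewrite mem_tri /tri_in /m /=; lia.
  have mt' : m' \in tri by rewrite mem_tri /tri_in /m' /=; lia.
  have m_left : tri_left m = false by rewrite /tri_left /m /=; lia.
  have m_left' : tri_left m' = true by rewrite /tri_left /m' /=; lia.
  have beE : tri_be m = m'.
    rewrite /tri_be m_left /m /m' /= eqxx; case: ifP => [|_]; first by clear -j_gt0; lia.
    by congr pair; clear; lia.
  have low_m : lower tri_cell tri_al m = false.
    by rewrite /lower /tri_cell /= /tri_row tri_left_al m_left /= eqxx; clear -q_gt0; lia.
  have low_m' : lower tri_cell tri_al m' = true.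
    by rewrite /lower /tri_cell /= /tri_row tri_left_al m_left' /= eqxx; clear -q_gt0; lia.
  apply: (@conn_trans _ _ m).
    by apply: conn1; rewrite /link lt mt (negPf nlow) low_m /K l0_gt0 orbT.
  apply: (@conn_trans _ _ m'); first by apply: conn1; rewrite /link mt mt' beE eqxx.
  by apply: conn1; rewrite /link mt' top_in low_m' lower_top /K orbT.
move=> lt; have [l0|l0] := boolP (0 < l.1); first exact: above.
have [bt _ _ _] := tri_beP lt.
apply: (@conn_trans _ _ (tri_be l)); first by apply: conn1; rewrite /link lt bt eqxx.
apply: above => //; move: l0; case/triP: lt => [a aj|a aj|a aj|a aj|b bj] /= a0;
  rewrite /tri_be /=; do ?[case: ifP => ? /=]; lia.
Qed.

End Known.

End Triangle.

(** ** Induction on the level of a column *)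

(** The first j steps of length q from z change the side of the column in its
    domino, and the next one does not. *)
Definition level (z : int) (j : nat) : Prop :=
  (forall a : int, 0 <= a <= j%:Z -> left p (z + a * q%:Z) = ~~ odd (absz a)) /\
  left p (z + j.+1%:Z * q%:Z) = ~~ odd j.

Lemma level_left z j : level z j -> left p z.
Proof. by case=> /(_ 0) + _; rewrite mul0r addr0 => -> //; lia. Qed.

(** The p steps of length q from z have total length qp, so the last side
    differs from the first one exactly if q is odd. If each of the p steps changed
    the side, it would do so exactly if p is odd. *)
Lemma level_exists z : left p z -> exists2 j, (j < p)%N & level z j.
Proof.
move=> zl; pose P j := (left p (z + j.+1%:Z * q%:Z) == left p (z + j%:Z * q%:Z)).
have [j jP] : exists j, (j < p)%N && P j.
  case: (boolP [exists j : 'I_p, P j]) => [/existsP[j Pj]|/existsPn noP].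
    by exists j; rewrite ltn_ord.
  have alt (j : nat) : (j <= p)%N -> left p (z + j%:Z * q%:Z) = ~~ odd j.
    elim: j => [|j IH] jp; first by rewrite mul0r addr0 zl.
    have := noP (Ordinal jp); rewrite /P /= IH; last by lia.
    by case: (left p _) => /=; case: (odd j).
  have := alt p (leqnn _); rewrite [p%:Z * _]mulrC leftDM // zl /=.
  by move: odd_pq; rewrite oddD; case: (odd p) (odd q) => [] [].
have exP : exists j, (j < p)%N && P j by exists j.
have [k /andP[kp Pk] kmin] := ex_minnP exP.
have alt (i : nat) : (i <= k)%N -> left p (z + i%:Z * q%:Z) = ~~ odd i.
  elim: i => [|i IH] ik; first by rewrite mul0r addr0 zl.
  have Pi : ~~ P i by apply/negP => Pi; have := kmin i; rewrite Pi andbT; lia.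
  by move: Pi; rewrite /P IH; [case: (left p _) => /=; case: (odd i)|lia].
exists k => //; split; last by rewrite (eqP Pk) alt.
by move=> [a|a] ak; [apply: alt; lia|lia].
Qed.

Lemma level_shift z j (a b : int) : level z j -> 0 <= a <= j%:Z -> ~~ odd (absz (a + b)) ->
  level (z + a * q%:Z + b * p%:Z) (j - absz a).
Proof.
move=> [lz lz1] aj ab.
have sh c : left p (z + a * q%:Z + b * p%:Z + c * q%:Z) = left p (z + (a + c) * q%:Z) (+) odd (absz b).
  by rewrite -leftDM //; congr left; lia.
split=> [c cj|]; rewrite sh; first by rewrite lz; lia.
rewrite (_ : a + _ = j.+1%:Z); last by lia.
by rewrite lz1; lia.
Qed.

Definition rungs (x : int) : Prop := forall y1 y2 : int,
  absz (y2 - y1) = p -> merges (x, y1) (x + q%:Z, y2).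

(** The rungs for +p follow from those for -p, by the reflection of rows. *)
Lemma rungs_of x (c d : int) : absz (d - c) = p ->
  (forall y, merges (x, y + c) (x + q%:Z, y + d)) -> rungs x.
Proof.
move=> cd M y1 y2 y12; have [E|E] : y2 - y1 = d - c \/ y2 - y1 = - (d - c) by lia.
  by have := M (y1 - c); rewrite (_ : _ - c + d = y2) ?subrK //; lia.
have := merges_flip (M (- y1 - c)); rewrite subrK opprK.
by rewrite (_ : - (_ + d) = y2) //; lia.
Qed.

(** A bound for the columns of the triangle with apex z. *)
Definition reach (z : int) (j : nat) : int := z + j.+1%:Z * (p%:Z + q%:Z).

Definition climbs (j : nat) : Prop := forall z, level z j -> 0 <= z -> reach z j < W%:Z ->
  rungs z /\ rungs (z + p%:Z).

Definition slides (j : nat) : Prop := forall z, level z j -> 0 <= z ->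
  reach z j + (2 * p)%N%:Z < W%:Z -> forall y, merges (z, y) (z + (2 * p)%N%:Z, y).

Lemma tau_left x : left p x -> tau x = x + p%:Z.
Proof. by rewrite /partner => ->. Qed.

Lemma climbs0 : climbs 0.
Proof.
move=> z zj z0 zW; have zl := level_left zj.
have zql : left p (z + q%:Z) by case: zj => _; rewrite mul1r.
have [zC zqC zpC zpqC] : [/\ in_cols z, in_cols (z + q%:Z), in_cols (z + p%:Z)
    & in_cols (z + p%:Z + q%:Z)].
  by move: zW; rewrite /reach /in_cols mul1r; clear -z0; split; lia.
have R y : merges (z, y) (z + q%:Z, y + p%:Z).
  by apply: merges_rung => //; clear -lt_pq; lia.
split; first by apply: (@rungs_of z 0 p%:Z) => [|y]; rewrite ?addr0; [lia|apply: R].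
apply: (@rungs_of _ 0 p%:Z) => [|y]; first by lia.
rewrite addr0; have := merges_tau y zpC; rewrite -(tau_left zl) (partnerK p_gt0) (tau_left zl) => M.
apply: merges_trans M (merges_trans (R _) _).
have := merges_tauN (y + q%:Z + p%:Z) zqC; rewrite tau_left // (addrAC z).
by rewrite (_ : y + _ + _ - _ = y + p%:Z) //; lia.
Qed.

Lemma slides0 : slides 0.
Proof.
move=> z zj z0 zW y; have zl := level_left zj.
have zql : left p (z + q%:Z) by case: zj => _; rewrite mul1r.
by apply: merges_2p => //; move: zW; rewrite /reach mul1r; clear; lia.
Qed.

(** The columns of the legs have lower level than the apex. So their rungs merge
    the legs with the base, and the slides of level 0, next to the base, merge
    the dominoes of the base with each other. *)
Lemma climbs_step j : (0 < j < p)%N -> slides 0 -> (forall i, (i < j)%N -> climbs i) -> climbs j.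
Proof.
case/andP=> j_gt0 j_ltp sl IH z zj z0 zW; have [lz lz1] := zj.
have legs (a b y1 y2 : int) : 0 < a <= j%:Z -> b = - a \/ b = a + 1 ->
    absz (y2 - y1)%R = p ->
    merges (z + a * q%:Z + b * p%:Z, y1) (z + (a + 1) * q%:Z + b * p%:Z, y2).
  move=> aj bE y12.
  have toq x : x + q%:Z + b * p%:Z = x + b * p%:Z + q%:Z by lia.
  rewrite mulrDl mul1r addrA toq.
  have lt_j : (j - absz a < j)%N by lia.
  case: bE => bE.
    have lv : level (z + a * q%:Z + b * p%:Z) (j - absz a) by apply: level_shift => //; lia.
    have [||R _] := IH _ lt_j _ lv; last exact: R.
      by move: (mulr_ge0 (x := a) (y := q%:Z - p%:Z)); lia.
    move: zW; rewrite /reach (_ : (j - absz a).+1%:Z = j.+1%:Z - a); last by lia.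
    by move: (mulr_ge0 (x := a) (y := p%:Z)); lia.
  have lv : level (z + a * q%:Z + a * p%:Z) (j - absz a) by apply: level_shift => //; lia.
  have [||_ R] := IH _ lt_j _ lv.
  - by move: (mulr_ge0 (x := a) (y := q%:Z)) (mulr_ge0 (x := a) (y := p%:Z)); lia.
  - by move: zW; rewrite /reach (_ : (j - absz a).+1%:Z = j.+1%:Z - a); lia.
  by rewrite bE mulrDl mul1r addrA; apply: R.
have base (b y1 : int) : - j%:Z <= b <= j%:Z - 2 -> ~~ odd (absz (j%:Z + b)) ->
    merges (z + j.+1%:Z * q%:Z + b * p%:Z, y1) (z + j.+1%:Z * q%:Z + (b + 2) * p%:Z, y1).
  move=> bj bodd.
  have lv (c : int) : - j%:Z <= c <= j%:Z -> ~~ odd (absz (j%:Z + c)) ->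
      [/\ level (z + j%:Z * q%:Z + c * p%:Z) 0, 0 <= z + j%:Z * q%:Z + c * p%:Z
        & reach (z + j%:Z * q%:Z + c * p%:Z) 0 <= reach z j - (j%:Z - c) * p%:Z].
    move=> cj codd; split.
    - by rewrite -(subnn j); apply: (level_shift (a := j%:Z) zj) => //; lia.
    - by move: (mulr_ge0 (x := j%:Z + c) (y := p%:Z)) (mulr_ge0 (x := j%:Z) (y := q%:Z - p%:Z)); lia.
    - by rewrite /reach; lia.
  have R (c : int) : - j%:Z <= c <= j%:Z -> ~~ odd (absz (j%:Z + c)) ->
      merges (z + j.+1%:Z * q%:Z + c * p%:Z, y1) (z + j%:Z * q%:Z + c * p%:Z, y1 - p%:Z).
    move=> cj codd; have [lc c0 cW] := lv c cj codd.
    have [|Rc _] := IH 0%N j_gt0 _ lc c0.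
      by move: (mulr_ge0 (x := j%:Z - c) (y := p%:Z)); lia.
    apply: merges_sym.
    rewrite (_ : z + j.+1%:Z * q%:Z + c * p%:Z = z + j%:Z * q%:Z + c * p%:Z + q%:Z); last by lia.
    by apply: Rc; lia.
  apply: merges_trans (R b _ bodd) _; first by lia.
  apply: merges_trans (merges_sym (R (b + 2) _ _)); [|lia|lia].
  have [lb b0 bW] := lv b ltac:(lia) bodd.
  have := sl _ lb b0 _ (y1 - p%:Z).
  rewrite (_ : z + j%:Z * q%:Z + b * p%:Z + (2 * p)%N%:Z = z + j%:Z * q%:Z + (b + 2) * p%:Z); last by lia.
  by apply; move: (mulr_ge0 (x := j%:Z - 2 - b) (y := p%:Z)); lia.
have inT (a b : int) : 0 <= a <= 1 -> 0 <= b <= 1 -> (a, b) \in tri j.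
  by move=> a1 b1; rewrite mem_tri /tri_in /=; lia.
have M (b y : int) : 0 <= b <= 1 ->
    merges (z + b * p%:Z, y + tri_row j (0, b)) (z + b * p%:Z + q%:Z, y + tri_row j (1, b)).
  move=> b1; have := tri_merges y j_gt0 j_ltp z0 zW lz lz1 legs base
    (inT 0 b isT b1) (inT 1 b isT b1).
  by rewrite /tri_cell /= mul0r addr0 mul1r (addrAC z).
have up b : absz (tri_row j (1, b) - tri_row j (0, b))%R = p.
  by rewrite -(tri_row_up (j := j) b (a := 0)) ?add0r.
split; first by apply: (rungs_of (up 0)) => y; have := M 0 y isT; rewrite mul0r addr0.
by apply: (rungs_of (up 1)) => y; have := M 1 y isT; rewrite mul1r.
Qed.

(** One goes from z to level j by a rung, slides there, and comes back. *)
Lemma slides_step j : climbs j.+1 -> slides j -> slides j.+1.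
Proof.
move=> cl sl z zj z0 zW y; have zl := level_left zj.
have z2p : level (z + (2 * p)%N%:Z) j.+1.
  have := level_shift (a := 0) (b := 2) zj.
  by rewrite mul0r addr0 subn0 (_ : 2 * p%:Z = (2 * p)%N%:Z) //; apply; lia.
have [Rz _] : rungs z /\ rungs (z + p%:Z) by apply: cl => //; lia.
have [Rz2 _] : rungs (z + (2 * p)%N%:Z) /\ rungs (z + (2 * p)%N%:Z + p%:Z).
  by apply: cl => //; [lia|move: zW; rewrite /reach; lia].
pose x := z + q%:Z - p%:Z.
have xj : level x j.
  have := level_shift (a := 1) (b := -1) zj.
  by rewrite mul1r mulN1r subn1 /=; apply; lia.
have xl := level_left xj.
have x2l : left p (x + (2 * p)%N%:Z) by rewrite (_ : (2 * p)%N%:Z = 2 * p%:Z) // leftDM // xl.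
have x0 : 0 <= x by rewrite /x; lia.
have xW : reach x j + (2 * p)%N%:Z < W%:Z by move: zW; rewrite /reach /x; lia.
have [xC x2C] : in_cols x /\ in_cols (x + (2 * p)%N%:Z).
  by move: xW; rewrite /reach /in_cols; move: (mulr_ge0 (x := j%:Z) (y := p%:Z + q%:Z)); lia.
apply: merges_trans (Rz y (y + p%:Z) _) _; first lia.
apply: merges_trans (merges_sym (Rz2 y (y + p%:Z) _)); last lia.
have -> : z + q%:Z = tau x by rewrite tau_left // /x; lia.
have -> : z + (2 * p)%N%:Z + q%:Z = tau (x + (2 * p)%N%:Z) by rewrite tau_left // /x; lia.
have := merges_tau (y + p%:Z - q%:Z) xC; rewrite subrK => Mx.
have := merges_tau (y + p%:Z - q%:Z) x2C; rewrite subrK => Mx2.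
exact: merges_trans (merges_sym Mx) (merges_trans (sl x xj x0 xW _) Mx2).
Qed.

Lemma climbs_slides j : (j < p)%N -> climbs j /\ slides j.
Proof.
have [n] := ubnP j; elim: n j => // n IH [|j] jn jp; first by split; [apply: climbs0|apply: slides0].
have cl : climbs j.+1.
  apply: climbs_step slides0 _; first by rewrite jp.
  by move=> i ij; have [] := IH i ltac:(lia) ltac:(lia).
split=> //; apply: slides_step => //; have [] := IH j ltac:(lia) ltac:(lia) => //.
Qed.

(** ** All strands of the strip can be merged *)

(** Here the width 4pq matters: a triangle over the left half of the strip has
    width at most p(p + q), which is less than 2pq. *)
Lemma half_range z j : (j < p)%N -> left p z -> z < (2 * p * q)%N%:Z ->
  reach z j + (2 * p)%N%:Z < W%:Z.
Proof.
move=> jp; have [k [m [-> m_bd]]] := left_split p_gt0 z.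
rewrite leftE // => mp zh; have kq : k + 1 <= q%:Z by nia.
have zB : (2 * p)%N%:Z * (k + 1) <= (2 * p)%N%:Z * q%:Z by rewrite ler_pM2l //; lia.
have jB : j.+1%:Z * (p%:Z + q%:Z) <= p%:Z * (p%:Z + q%:Z) by rewrite ler_pM2r; lia.
have pB : p%:Z * (p%:Z + 1) <= p%:Z * q%:Z by rewrite ler_pM2l; lia.
by rewrite /reach; lia.
Qed.

Lemma half_rungs x : 0 <= x < (2 * p * q)%N%:Z -> rungs x.
Proof.
move=> xh; have [xl|xr] := boolP (left p x).
  have [j jp lx] := level_exists xl; have xW := half_range jp xl.
  have [cl _] := climbs_slides jp; have [||//] := cl x lx; lia.
have zl : left p (x - p%:Z) by rewrite leftB.
have z0 : 0 <= x - p%:Z.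
  have : in_cols (tau x) by apply: tau_in; rewrite /in_cols; lia.
  by rewrite /partner (negPf xr) /in_cols => /andP[].
have [j jp lz] := level_exists zl; have zW := half_range jp zl.
have [cl _] := climbs_slides jp; have [|_] := cl _ lz z0; first by lia.
by rewrite subrK.
Qed.

Lemma half_steps x y1 y2 : 0 <= x < (2 * p * q)%N%:Z -> absz (y2 - y1)%R = q ->
  merges (x, y1) (x + p%:Z, y2).
Proof.
move=> xh y12; have xC : in_cols x by rewrite /in_cols; lia.
have M : merges (x, y1) (tau x, y2).
  have [->|->] : y2 = y1 + q%:Z \/ y2 = y1 - q%:Z by lia.
    exact: merges_tau.
  exact: merges_tauN.
have [xl|xr] := boolP (left p x); first by rewrite -tau_left.
have zE : tau x = x - p%:Z by rewrite /partner (negPf xr).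
have zl : left p (x - p%:Z) by rewrite leftB.
have [j jp lz] := level_exists zl; have zW := half_range jp zl.
have z0 : 0 <= x - p%:Z by have := tau_in xC; rewrite zE /in_cols; lia.
apply: merges_trans M _; rewrite zE.
have [_ sl] := climbs_slides jp; have := sl _ lz z0 _ y2.
by rewrite (_ : x - p%:Z + _ = x + p%:Z); [apply; lia|lia].
Qed.

Lemma merges_stepq x y1 y2 : in_cols x -> in_cols (x + q%:Z) -> absz (y2 - y1)%R = p ->
  merges (x, y1) (x + q%:Z, y2).
Proof.
move=> xC xqC y12; have [xh|xh] := ltrP x (2 * p * q)%N%:Z.
  by apply: half_rungs => //; move: xC; rewrite /in_cols; lia.
pose x' := W%:Z - 1 - (x + q%:Z).
have R : rungs x' by apply: half_rungs; move: xqC; rewrite /x' /in_cols; lia.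
have M : merges (W%:Z - 1 - x', y2) (W%:Z - 1 - (x' + q%:Z), y1).
  by apply/merges_mirror/R; rewrite distnC.
have E : W%:Z - 1 - x' = x + q%:Z /\ W%:Z - 1 - (x' + q%:Z) = x by rewrite /x'; lia.
by case: E M => -> -> /merges_sym.
Qed.

Lemma merges_stepp x y1 y2 : in_cols x -> in_cols (x + p%:Z) -> absz (y2 - y1)%R = q ->
  merges (x, y1) (x + p%:Z, y2).
Proof.
move=> xC xpC y12; have [xh|xh] := ltrP x (2 * p * q)%N%:Z.
  by apply: half_steps => //; move: xC; rewrite /in_cols; lia.
pose x' := W%:Z - 1 - (x + p%:Z).
have M : merges (W%:Z - 1 - x', y2) (W%:Z - 1 - (x' + p%:Z), y1).
  apply/merges_mirror/half_steps; last by rewrite distnC.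
  by move: xpC; rewrite /x' /in_cols; lia.
have E : W%:Z - 1 - x' = x + p%:Z /\ W%:Z - 1 - (x' + p%:Z) = x by rewrite /x'; lia.
by case: E M => -> -> /merges_sym.
Qed.

(** Two leaps there and back give a vertical shift by 2p. *)
Lemma merges_2p_rows x y (n : int) : in_cols x -> merges (x, y) (x, y + (2 * p)%N%:Z * n).
Proof.
move=> xC.
have up y' : merges (x, y') (x, y' + (2 * p)%N%:Z).
  have [xq|xq] := boolP (in_cols (x + q%:Z)).
    apply: merges_trans (merges_stepq (y2 := y' + p%:Z) xC xq _) _; first by lia.
    by apply: merges_sym; apply: merges_stepq => //; lia.
  have xq' : in_cols (x - q%:Z) by move: xC xq; rewrite /in_cols; nia.
  have xE : x - q%:Z + q%:Z = x by rewrite subrK.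
  apply: merges_trans (_ : merges _ (x - q%:Z, y' + p%:Z)) _.
    by apply: merges_sym; rewrite -{2}xE; apply: merges_stepq; rewrite ?xE //; lia.
  by rewrite -{2}xE; apply: merges_stepq; rewrite ?xE //; lia.
have upn (m : nat) y' : merges (x, y') (x, y' + (2 * p)%N%:Z * m%:Z).
  elim: m => [|m IH]; first by rewrite mulr0 addr0; apply: merges_refl.
  apply: merges_trans IH _; have := up (y' + (2 * p)%N%:Z * m%:Z).
  by rewrite (_ : y' + _ + _ = y' + (2 * p)%N%:Z * m.+1%:Z) //; lia.
case: n => n; first exact: upn.
rewrite NegzE; have /merges_sym := upn n.+1 (y + (2 * p)%N%:Z * - n.+1%:Z).
by rewrite (_ : y + _ + _ = y) //; lia.
Qed.

Lemma merges_parity x y1 y2 : in_cols x -> ~~ odd (absz (y2 - y1)%R) -> merges (x, y1) (x, y2).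
Proof.
move=> xC y12; have [u v uv _] := egcdnP q p_gt0.
have {}uv : u%:Z * p%:Z - v%:Z * q%:Z = 1.
  by move: uv; rewrite (eqP co_pq); lia.
have [t tE] : exists t : int, y2 - y1 = 2 * t.
  exists (if 0 <= y2 - y1 then (absz (y2 - y1)%R)./2%:Z else - (absz (y2 - y1)%R)./2%:Z).
  by case: ifP; lia.
apply: merges_trans (merges_2p_rows y1 (t * u%:Z) xC) _.
have := merges_2q (y1 + (2 * p)%N%:Z * (t * u%:Z)) (- (t * v%:Z)) xC.
have E : 2 * t * (u%:Z * p%:Z - v%:Z * q%:Z) = 2 * t by rewrite uv mulr1.
by rewrite (_ : y1 + _ + _ = y2) //; lia.
Qed.

(** The leaper runs round the columns 0, ..., p + q - 1 by steps p and -q; since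
    p + q is odd, one round trip changes the parity of the row. *)
Lemma merges_ring n : exists2 y : int,
  merges (0, 0) (((n * p) %% (p + q))%N%:Z, y) &
  odd (absz y + (n * p) %% (p + q) + n) = false.
Proof.
have W_big : (p + q < W)%N by nia.
elim: n => [|n [y M y_par]].
  by exists 0; rewrite mul0n mod0n //; apply: merges_refl; rewrite /in_cols /=; lia.
have r_lt : ((n * p) %% (p + q) < p + q)%N by rewrite ltn_mod; lia.
have rE : ((n.+1 * p) %% (p + q) = ((n * p) %% (p + q) + p) %% (p + q))%N.
  by rewrite modnDml mulSn addnC.
rewrite {}rE; move: M y_par r_lt; move: ((n * p) %% (p + q))%N => r M y_par r_lt.
have rC : in_cols r%:Z by rewrite /in_cols; lia.
have [rq|rq] := ltnP r q.
  rewrite modn_small; last by lia.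
  exists (y + q%:Z); last by clear -y_par odd_pq; lia.
  by apply: merges_trans M _; rewrite PoszD; apply: merges_stepp => //; rewrite /in_cols; lia.
rewrite (_ : r + p = (r - q) + (p + q))%N; last by lia.
rewrite modnDr modn_small; last by lia.
exists (y + p%:Z); last by clear -y_par odd_pq rq; lia.
apply: merges_trans M _; apply: merges_sym.
have rE : r%:Z = (r - q)%N%:Z + q%:Z by clear -rq; lia.
rewrite rE; apply: merges_stepq; rewrite -?rE //; last by clear; lia.
by move: rC; rewrite /in_cols; clear -rq; lia.
Qed.

Lemma merges_origin (x : nat) y : in_cols x%:Z -> merges (0, 0) (x%:Z, y).
Proof.
have [n] := ubnP x; elim: n x y => // n IH x y xn xC.
have [x_lt|x_ge] := ltnP x (p + q).
  have co : coprime (p + q) p by rewrite coprime_sym /coprime gcdnDl.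
  pose m := chinese (p + q) p x 0.
  have /dvdnP[k kE] : (p %| m)%N by rewrite /dvdn /m chinese_modr // mod0n.
  have mE : (m %% (p + q) = x)%N by rewrite /m chinese_modl // modn_small.
  have [l lE l_par] : exists2 l, ((l * p) %% (p + q) = x)%N & odd (absz y + x + l) = false.
    have [par|par] := boolP (odd (absz y + x + k)); last first.
      by exists k; [rewrite -kE|exact/negbTE].
    exists (k + (p + q))%N; first by rewrite mulnDl addnC [((p + q) * p)%N]mulnC modnMDl -kE.
    by rewrite addnA oddD par odd_pq.
  have [y' M y'_par] := merges_ring l; rewrite lE in M y'_par.
  by apply: merges_trans M _; apply: merges_parity => //; lia.
have xE : x%:Z = (x - q)%N%:Z + q%:Z by lia.
have xqC : in_cols (x - q)%N%:Z by move: xC; rewrite /in_cols; lia.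
apply: merges_trans (IH (x - q)%N (y + p%:Z) _ xqC) _; first by lia.
by rewrite xE; apply: merges_stepq; rewrite -?xE //; lia.
Qed.

Lemma merges_any s s' : in_cols s.1 -> in_cols s'.1 -> merges s s'.
Proof.
case: s s' => [[x|x] y] [[x'|x'] y'] /= xC x'C; try by move: xC x'C; rewrite /in_cols; lia.
exact: merges_trans (merges_sym (merges_origin y xC)) (merges_origin y' x'C).
Qed.

(** ** A two-factor of the half-strip that climbs *)

Local Notation N := (p + q)%N.

Definition mid_row : int := ((p + q).-1./2)%:Z.

(** The walk on rows by steps p and -q stays in a block of N = p + q consecutive
    rows. At time v it is in row mid_row + v p modulo N of its block, and slow v
    tells that the next step is p. The start mid_row makes this invariant under
    reversal of time (slowN). *)
Definition slow (v : int) : bool := ((mid_row + v * p%:Z) %% N%:Z)%Z < q%:Z.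

Definition lat_row (i : int * int) : int := mid_row + i.1 * p%:Z + i.2 * q%:Z.

(** A row y together with a colour b has a unique pair of coordinates (c, k) with
    0 <= c < 2q, y = mid_row + c p + k q and parity of c + k equal to b. They are
    obtained from the Bezout coefficients of p and q; (c + 2q, k) is identified
    with (c, k + 2p). *)
Definition lat (y : int) (b : bool) : int * int :=
  let c := (y - mid_row) * (egcdn p q).1%:Z in
  let k := - ((y - mid_row) * (egcdn p q).2%:Z) in
  let ck := if odd (absz (c + k)) == b then (c, k) else (c + q%:Z, k - p%:Z) in
  ((ck.1 %% (2 * q)%N%:Z)%Z, ck.2 + (2 * p)%N%:Z * (ck.1 %/ (2 * q)%N%:Z)%Z).

Lemma mid_rowE : 2 * mid_row + 1 = N%:Z.
Proof. by rewrite /mid_row; lia. Qed.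

Lemma latP y b : let i := lat y b in
  [/\ 0 <= i.1 < (2 * q)%N%:Z, lat_row i = y & odd (absz (i.1 + i.2)) = b].
Proof.
rewrite /lat; case: (egcdnP q p_gt0) => u v uv _ /=.
have {}uv : u%:Z * p%:Z - v%:Z * q%:Z = 1 by move: uv; rewrite (eqP co_pq); lia.
set c := (y - _) * _; set k := - _.
have ckE : c * p%:Z + k * q%:Z = y - mid_row.
  have : (y - mid_row) * (u%:Z * p%:Z - v%:Z * q%:Z) = y - mid_row by rewrite uv mulr1.
  by rewrite /c /k; clear; lia.
set ck := if _ then _ else _.
have [ckE' ck_par] : ck.1 * p%:Z + ck.2 * q%:Z = y - mid_row /\ odd (absz (ck.1 + ck.2)) = b.
  by rewrite /ck; case: eqP => /= b_par; split=> //; move: odd_pq ckE b_par; clear; case: b; lia.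
have dE := divz_eq ck.1 (2 * q)%N%:Z; have m0 := modz_ge0 ck.1 (_ : (2 * q)%N%:Z != 0).
have m1 := ltz_pmod ck.1 (_ : (2 * q)%N%:Z > 0).
split=> /=.
- by rewrite m0 ?m1 //; clear -q_gt0; lia.
- rewrite /lat_row /=; move: dE; move: (ck.1 %% _)%Z (ck.1 %/ _)%Z => m d dE.
  by move: ckE'; rewrite dE; clear; lia.
- rewrite -ck_par; move: dE; move: (ck.1 %% _)%Z (ck.1 %/ _)%Z => m d dE.
  by clear -dE; lia.
Qed.

Lemma lat_row_inj (i i' : int * int) : 0 <= i.1 < (2 * q)%N%:Z -> 0 <= i'.1 < (2 * q)%N%:Z ->
  lat_row i = lat_row i' -> odd (absz (i.1 + i.2)) = odd (absz (i'.1 + i'.2)) -> i = i'.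
Proof.
case: i i' => c k [c' k'] /= cb c'b rE pE.
have [|n [n1 n2]] := @pq_split (k' - k) (c - c'); first by move: rE; rewrite /lat_row /=; lia.
have : n = 0 \/ n = 1 \/ n = -1 by clear -n2 cb c'b q_gt0; nia.
case=> [|[]] nE; rewrite nE in n1 n2; first by congr pair; lia.
  by exfalso; clear -n1 n2 pE odd_pq; lia.
by exfalso; clear -n1 n2 pE odd_pq; lia.
Qed.

Lemma latE y b (i : int * int) : 0 <= i.1 < (2 * q)%N%:Z -> lat_row i = y ->
  odd (absz (i.1 + i.2)) = b -> lat y b = i.
Proof.
move=> ib rE pE; have [lb lr lp] := latP y b.
by apply: lat_row_inj => //; rewrite ?lr ?lp ?rE ?pE.
Qed.

Lemma slow_row (c k : int) : slow (c - k) = ((lat_row (c, k) %% N%:Z)%Z < q%:Z).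
Proof.
rewrite /slow /lat_row /= (_ : mid_row + c * p%:Z + k * q%:Z = k * N%:Z + (mid_row + (c - k) * p%:Z)).
  by rewrite modzMDl.
by lia.
Qed.

Lemma slowN (v : int) : slow (- 1 - v) = slow v.
Proof.
rewrite /slow (_ : mid_row + (-1 - v) * p%:Z = q%:Z - 1 - (mid_row + v * p%:Z)).
  have dE := divz_eq (mid_row + v * p%:Z) N%:Z.
  have m0 := modz_ge0 (mid_row + v * p%:Z) (_ : N%:Z != 0).
  have m1 := ltz_pmod (mid_row + v * p%:Z) (_ : N%:Z > 0).
  move: dE m0 m1; set d := (_ %/ _)%Z; set m := (_ %% _)%Z => dE m0 m1.
  have {}m0 : 0 <= m by apply: m0; lia.
  have {}m1 : m < N%:Z by apply: m1; lia.
  have [mq|mq] := ltrP m q%:Z.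
    rewrite (_ : q%:Z - 1 - _ = - d * N%:Z + (q%:Z - 1 - m)); last by lia.
    by rewrite modzMDl modz_small; lia.
  rewrite (_ : q%:Z - 1 - _ = (- d - 1) * N%:Z + (q%:Z - 1 - m + N%:Z)); last by lia.
  by rewrite modzMDl modz_small; lia.
have := mid_rowE; lia.
Qed.

Lemma slow_period (v n : int) : slow (v + n * N%:Z) = slow v.
Proof.
rewrite /slow (_ : mid_row + (v + n * N%:Z) * p%:Z = (n * p%:Z) * N%:Z + (mid_row + v * p%:Z)).
  by rewrite modzMDl.
by lia.
Qed.

Lemma slow0 : slow 0.
Proof.
by rewrite /slow mul0r addr0 modz_small; have := mid_rowE; lia.
Qed.

Lemma fast_row (c k : int) : 0 <= lat_row (c, k) -> ~~ slow (c - k) -> q%:Z <= lat_row (c, k).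
Proof.
rewrite slow_row => r0 /negP rq; rewrite leNgt; apply/negP => r_lt; apply: rq.
by rewrite modz_small //; lia.
Qed.

Lemma slow_row_ge (c k : int) : 0 <= lat_row (c, k) -> slow (c - 1 - k) -> p%:Z <= lat_row (c, k).
Proof.
rewrite slow_row => r0 rq; rewrite leNgt; apply/negP => r_lt; move: rq.
have rE : lat_row (c - 1, k) = lat_row (c, k) - p%:Z by rewrite /lat_row /=; lia.
rewrite rE (_ : _ - _ = -1 * N%:Z + (lat_row (c, k) + q%:Z)); last by lia.
by rewrite modzMDl modz_small; lia.
Qed.

(** In the ringed part the walk goes round its block: c - k is its time. In the
    rest, the open part, it goes up. *)
Definition ringed (i : int * int) : bool := (i.2 < 0) || (N%:Z <= i.1 - i.2).

(** capP tells whether (c, k) is joined to (c + 1, k), that is, to the row p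
    higher; capQ tells whether it is joined to (c, k + 1), the row q higher. In
    capQ, the first two disjuncts are the steps of the walk in the ringed part
    (downwards) and in the open part. The last two join a ringed row to an open
    one, both of which have no predecessor on the walk. *)
Definition capP (i : int * int) : bool :=
  if ringed i then slow (i.1 - i.2)
  else (i.1 + i.2 + 1 < N%:Z) && slow (i.1 + i.2 + 1).

Definition capQ (i : int * int) : bool :=
  [|| ringed (i.1, i.2 + 1) && ~~ slow (i.1 - i.2 - 1), ~~ ringed i && ~~ capP i,
      [&& i.2 == -1, 1 <= i.1 < N%:Z & ~~ slow i.1] | (0 <= i.2) && (i.1 - i.2 == N%:Z)].

Definition rowP (y : int) (b : bool) : bool := (0 <= y) && capP (lat y b).
Definition rowQ (y : int) (b : bool) : bool := (0 <= y) && capQ (lat y b).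

Definition back (i : int * int) : int * int :=
  if i.1 == 0 then ((2 * q)%N%:Z - 1, i.2 - (2 * p)%N%:Z) else (i.1 - 1, i.2).

Lemma lat_back y b : lat (y - p%:Z) (~~ b) = back (lat y b).
Proof.
have [ib rE pE] := latP y b; move: ib rE pE; case: (lat y b) => c k /= cb rE pE.
apply: latE; rewrite /back /=; case: eqP => cE /=.
- by lia.
- by lia.
- by move: rE; rewrite /lat_row /= cE; lia.
- by move: rE; rewrite /lat_row /=; lia.
- by move: pE; rewrite cE; clear; case: b; lia.
- by move: pE; clear; case: b; lia.
Qed.

Lemma lat_down y b : lat (y - q%:Z) (~~ b) = ((lat y b).1, (lat y b).2 - 1).
Proof.
have [ib rE pE] := latP y b; move: ib rE pE; case: (lat y b) => c k /= cb rE pE.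
apply: latE => //=; first by move: rE; rewrite /lat_row /=; lia.
by move: pE; clear; case: b; lia.
Qed.

(** Of the four rows at distance p and q, exactly one is the successor on the walk
    and exactly one is the predecessor, or its substitute. In the ringed part the
    successor is up by p or down by q, and the predecessor is down by p or up by
    q; in the open part, the successor is up and the predecessor is down. *)
Section Degrees.

Variables c k : int.
Hypotheses (c_bd : 0 <= c < (2 * q)%N%:Z) (r0 : 0 <= lat_row (c, k)).

Let inP : bool := (0 <= lat_row (c, k) - p%:Z) && capP (back (c, k)).
Let inQ : bool := (0 <= lat_row (c, k) - q%:Z) && capQ (c, k - 1).

Lemma ringed_c : ringed (c, k) -> 1 <= c.
Proof.
rewrite /ringed /= => cR; have k_neg : c = 0 -> k < 0 by lia.
have [c0|] := eqVneq c 0; last by lia.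
exfalso; move: r0; rewrite /lat_row /= c0; have := k_neg c0; have := mid_rowE; nia.
Qed.

Lemma ringed_inQ : ringed (c, k) -> inQ = ~~ capP (c, k).
Proof.
move=> cR; rewrite /inQ /capP cR /capQ /= subrK cR /=.
have -> : ringed (c, k - 1) by move: cR; rewrite /ringed /=; lia.
rewrite (_ : c - (k - 1) - 1 = c - k); last by lia.
have -> : [&& k - 1 == -1, 1 <= c < N%:Z & ~~ slow c] = false by move: cR; rewrite /ringed /=; lia.
have -> : (0 <= k - 1) && (c - (k - 1) == N%:Z) = false by move: cR; rewrite /ringed /=; lia.
rewrite !orbF; case sl: (slow (c - k)) => /=; first by rewrite andbF.
by have := fast_row r0 (negbT sl); lia.
Qed.

Lemma ringed_outQ : ringed (c, k) -> capQ (c, k) = ~~ inP.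
Proof.
move=> cR; have c1 := ringed_c cR.
rewrite /inP /capQ /back /= (_ : (c == 0) = false) ?cR /=; last by lia.
have inP_eq b : b = slow (c - 1 - k) -> (0 <= lat_row (c, k) - p%:Z) && b = b.
  by move=> ->; case sl: (slow _); rewrite ?andbF ?andbT //; have := slow_row_ge r0 sl; lia.
rewrite (_ : c - k - 1 = c - 1 - k); last by lia.
move: cR; rewrite /ringed /=; have [k0|k0] /= := ltrP k 0 => cR.
  rewrite /capP /ringed /= k0 /= inP_eq //.
  have [k1|k1] := eqVneq k (-1); last first.
    by rewrite (_ : (k + 1 < 0) = true) /= ?orbF //; lia.
  rewrite k1 (_ : c - 1 - -1 = c); last by lia.
  by case: (slow c); rewrite ?andbF ?andbT /=; lia.
rewrite (_ : (k == -1) = false) /=; last by lia.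
rewrite (_ : k + 1 < 0 = false) /=; last by lia.
have [ckN|ckN] := eqVneq (c - k) N%:Z.
  rewrite orbT /capP /ringed /= (_ : (k < 0) = false) /=; last by lia.
  rewrite (_ : N%:Z <= c - 1 - k = false); last by lia.
  rewrite (_ : c - 1 + k + 1 < N%:Z = false) /= ?andbF //; last by lia.
rewrite orbF (_ : N%:Z <= c - (k + 1)) /=; last by lia.
by rewrite /capP /ringed /= (_ : N%:Z <= c - 1 - k) ?orbT ?inP_eq //; lia.
Qed.

Lemma open_outQ : ~~ ringed (c, k) -> capQ (c, k) = ~~ capP (c, k).
Proof.
move=> cA; rewrite /capQ cA /=.
have -> : ringed (c, k + 1) = false by move: cA; rewrite /ringed /=; lia.
have -> : (k == -1) = false by move: cA; rewrite /ringed /=; lia.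
have -> : (c - k == N%:Z) = false by move: cA; rewrite /ringed /=; lia.
by rewrite andbF !orbF.
Qed.

Lemma open_inQ : ~~ ringed (c, k) -> inQ = ~~ inP.
Proof.
rewrite /inQ /inP /capQ /back /= subrK => cA; rewrite (negPf cA) /=.
have [k0 ckN] : 0 <= k /\ c - k < N%:Z by move: cA; rewrite /ringed /=; lia.
have [c0|cN] := eqVneq c 0.
  have r1 := r0; rewrite c0 in r1 *.
  have P_eq : capP ((2 * q)%N%:Z - 1, k - (2 * p)%N%:Z) = (k < N%:Z) && slow k.
    (* Closing the ring uses the symmetry of slow under reversal of time. *)
    rewrite /capP /ringed /=; have [kN|kN] /= := ltrP k N%:Z.
      rewrite (_ : (k - (2 * p)%N%:Z < 0) || _); last by lia.
      rewrite (_ : _ - _ = -1 - k + 2 * N%:Z); last by lia.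
      by rewrite slow_period slowN.
    rewrite (_ : (k - (2 * p)%N%:Z < 0) || _ = false) /=; last by lia.
    by rewrite (_ : (_ < N%:Z) = false) //; lia.
  rewrite P_eq.
  have [k_eq0|k_gt0] : k = 0 \/ 0 < k by lia.
    rewrite k_eq0 /ringed /= slow0 !andbT.
    have rE : lat_row (0, 0) = mid_row by rewrite /lat_row /= !mul0r !addr0.
    by rewrite rE; have := mid_rowE; lia.
  have row_q : 0 <= lat_row (0, k) - q%:Z.
    have := mid_rowE; have := mulr_ge0 (x := k - 1) (y := q%:Z); rewrite /lat_row /=; lia.
  have row_p : 0 <= lat_row (0, k) - p%:Z by lia.
  rewrite row_q row_p /= /capP /ringed /=.
  rewrite (_ : (k - 1 < 0) || _ = false) /=; last by lia.
  rewrite (_ : 0 + (k - 1) + 1 = k); last by lia.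
  rewrite (_ : (_ == - 1) = false) /=; last by lia.
  by rewrite (_ : (_ == N%:Z) = false) ?andbF ?orbF //; lia.
have row_p : 0 <= lat_row (c, k) - p%:Z.
  have := mid_rowE; have := mulr_ge0 (x := c - 1) (y := p%:Z); have := mulr_ge0 (x := k) (y := q%:Z).
  by rewrite /lat_row /=; lia.
have P_eq : capP (c - 1, k) = (c + k < N%:Z) && slow (c + k).
  rewrite /capP /ringed /= (_ : (k < 0) || _ = false); last by lia.
  by rewrite (_ : c - 1 + k + 1 = c + k) //; lia.
rewrite row_p P_eq /=.
have [k_eq0|k_gt0] : k = 0 \/ 0 < k by lia.
  have r1 := r0; rewrite k_eq0 in r1 ckN *.
  rewrite /ringed /= addr0 (_ : c < N%:Z) /=; last by lia.
  rewrite (_ : 1 <= c) /= ?orbF; last by lia.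
  case sl: (slow c) => /=; rewrite ?andbF //.
  by have := @fast_row c 0 r1; rewrite subr0 sl => /(_ isT); lia.
have row_q : 0 <= lat_row (c, k) - q%:Z.
  have := mid_rowE; have := mulr_ge0 (x := c) (y := p%:Z); have := mulr_ge0 (x := k - 1) (y := q%:Z).
  by rewrite /lat_row /=; lia.
rewrite row_q /= (_ : (k - 1 == -1) = false) /=; last by lia.
rewrite (_ : 0 <= k - 1) /=; last by lia.
have [ckN'|ckN'] := eqVneq (c - (k - 1)) N%:Z.
  by rewrite orbT (_ : (c + k < N%:Z) = false) //; lia.
rewrite orbF /capP /ringed /= (_ : (k - 1 < 0) || _ = false) /=; last by lia.
by rewrite (_ : c + (k - 1) + 1 = c + k) //; lia.
Qed.

End Degrees.

(** The boolean b is the parity of x + y on the cells (x, y) of the row. *)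
Lemma row_degree (y : int) b : 0 <= y ->
  (rowP y b + rowP (y - p%:Z) (~~ b) + rowQ y b + rowQ (y - q%:Z) (~~ b))%N = 2%N.
Proof.
move=> y0; rewrite /rowP /rowQ y0 lat_back lat_down !andTb.
have [ib rE _] := latP y b; move: ib rE; case: (lat y b) => c k /= cb rE.
have r0 : 0 <= lat_row (c, k) by rewrite rE.
rewrite -rE.
have [cR|cA] := boolP (ringed (c, k)).
  rewrite ringed_inQ // ringed_outQ //.
  by case: (capP _); case: (_ && _).
rewrite open_outQ // open_inQ //.
by case: (capP _); case: (_ && _).
Qed.

(** ** Escaping from the bottom *)

Local Notation sig := (partner q).

Definition parity (u : cell) : bool := odd (absz (u.1 + u.2)).

Definition half : rel cell := fun u v =>
  let b := parity u in
  in_cols u.1 && [|| (v == (sig u.1, u.2 + p%:Z)) && rowP u.2 b,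
    (v == (sig u.1, u.2 - p%:Z)) && rowP (u.2 - p%:Z) (~~ b),
    (v == (tau u.1, u.2 + q%:Z)) && rowQ u.2 b
  | (v == (tau u.1, u.2 - q%:Z)) && rowQ (u.2 - q%:Z) (~~ b)].

Lemma sig_in x : in_cols x -> in_cols (sig x).
Proof.
by rewrite /in_cols (_ : 4 * p * q = 2 * q * (2 * p))%N; [apply: partner_bound|lia].
Qed.

Lemma parity_sig (x y y' : int) : absz (y' - y)%R = p -> parity (sig x, y') = ~~ parity (x, y).
Proof.
have := partner_dist q_gt0 x; rewrite /parity /=; move: (sig x) => x'.
by move: odd_pq; clear; lia.
Qed.

Lemma parity_tau (x y y' : int) : absz (y' - y)%R = q -> parity (tau x, y') = ~~ parity (x, y).
Proof.
have := partner_dist p_gt0 x; rewrite /parity /=; move: (tau x) => x'.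
by move: odd_pq; clear; lia.
Qed.

Lemma half_sym_imp (u v : cell) : half u v -> half v u.
Proof.
case: u v => x y [x' y'] /andP[/= xC].
case/or4P=> /andP[/eqP[-> ->] r]; rewrite /half /=.
- rewrite sig_in // partnerK // addrK (@parity_sig x y) ?negbK ?eqxx ?r ?orbT //; lia.
- rewrite sig_in // partnerK // subrK (@parity_sig x y) ?eqxx ?r ?orbT //; lia.
- rewrite tau_in // partnerK // addrK (@parity_tau x y) ?negbK ?eqxx ?r ?orbT //; lia.
- rewrite tau_in // partnerK // subrK (@parity_tau x y) ?eqxx ?r ?orbT //; lia.
Qed.

Lemma half_sym : symmetric half.
Proof. by move=> u v; apply/idP/idP; apply: half_sym_imp. Qed.

Lemma half_leap (u v : cell) : half u v -> leap u v.
Proof.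
case: u v => x y [x' y'] /andP[/= _].
have dt := partner_dist p_gt0 x; have ds := partner_dist q_gt0 x.
by case/or4P=> /andP[/eqP[-> ->] _]; rewrite /leaper_adj /=; lia.
Qed.

Lemma half_in (u v : cell) : half u v -> in_cols u.1 && (0 <= u.2).
Proof.
case: u v => x y v /andP[/= -> ].
by case/or4P=> /andP[_ /andP[r _]]; lia.
Qed.

Lemma half_two (u : cell) : in_cols u.1 -> 0 <= u.2 -> two_nbrs half u.
Proof.
case: u => x y /= xC y0; rewrite /two_nbrs /half /= xC /=.
have := row_degree (parity (x, y)) y0.
have pairP (a b : cell) (F : pred cell) : a.2 != b.2 -> (forall v, F v = (v == a) || (v == b)) ->
    exists a b : cell, a != b /\ forall v, F v = (v == a) || (v == b).
  by move=> ab Fab; exists a, b; split=> //; apply: contra ab => /eqP->.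
case: (rowP y _); case: (rowP (y - _) _); case: (rowQ y _); case: (rowQ (y - _) _) => //= _.
- apply: (pairP (sig x, y + p%:Z) (sig x, y - p%:Z)) => /= [|v]; first by lia.
  by rewrite !andbT !andbF ?orbF.
- apply: (pairP (sig x, y + p%:Z) (tau x, y + q%:Z)) => /= [|v]; first by lia.
  by rewrite !andbT !andbF ?orbF.
- apply: (pairP (sig x, y + p%:Z) (tau x, y - q%:Z)) => /= [|v]; first by lia.
  by rewrite !andbT !andbF ?orbF.
- apply: (pairP (sig x, y - p%:Z) (tau x, y + q%:Z)) => /= [|v]; first by lia.
  by rewrite !andbT !andbF ?orbF.
- apply: (pairP (sig x, y - p%:Z) (tau x, y - q%:Z)) => /= [|v]; first by lia.
  by rewrite !andbT !andbF ?orbF.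
apply: (pairP (tau x, y + q%:Z) (tau x, y - q%:Z)) => /= [|v]; first by lia.
by rewrite !andbT !andbF ?orbF.
Qed.

(** From row cap_height - q on, k is at least 2p + 2q, and all is open. *)
Definition cap_height : nat := ((4 * p + 2 * q + 3) * q)%N.

Lemma high_row (y : int) b : cap_height%:Z - q%:Z <= y -> rowP y b = false /\ rowQ y b.
Proof.
move=> yh; have [ib rE _] := latP y b; rewrite /rowP /rowQ.
have y0 : 0 <= y by move: yh; rewrite /cap_height; nia.
move: ib rE; case: (lat y b) => c k /= cb rE.
have kb : (2 * p + 2 * q)%N%:Z <= k.
  rewrite -(ler_pM2r (x := q%:Z)); last by lia.
  have := mulr_ge0 (x := (2 * q)%N%:Z - c) (y := p%:Z); have := mid_rowE.
  by move: rE yh; rewrite /lat_row /cap_height /=; lia.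
rewrite y0 /capQ /capP /ringed /=.
have -> : (k < 0) || (N%:Z <= c - k) = false by lia.
have -> : (c + k + 1 < N%:Z) = false by lia.
by rewrite /= !orbT.
Qed.

Lemma half_pure b : pure half cap_height%:Z b.
Proof.
move=> x y v xC /andP[yh _]; rewrite /half /= xC /=.
have [-> ->] : rowP y (parity (x, y)) = false /\ rowQ y (parity (x, y)) by apply: high_row; lia.
have [-> _] : rowP (y - p%:Z) (~~ parity (x, y)) = false /\ rowQ (y - p%:Z) (~~ parity (x, y)).
  by apply: high_row; lia.
have [_ ->] : rowP (y - q%:Z) (~~ parity (x, y)) = false /\ rowQ (y - q%:Z) (~~ parity (x, y)).
  by apply: high_row; lia.
by rewrite !andbF !andbT.
Qed.

(** Escapes use edges near the bottom only, because the two-factor of the whole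
    board contains these and their mirror images. *)
Definition low : rel cell := fun u v => half u v && ((u.2 < cap_height%:Z) || (v.2 < cap_height%:Z)).

Definition escapes (u : cell) : Prop := exists v : cell,
  [/\ conn low u v, in_cols v.1 & cap_height%:Z <= v.2 < cap_height%:Z + q%:Z].

Lemma escapes_step (u v : cell) : half u v -> (0 <= v.2 < cap_height%:Z + q%:Z -> escapes v) ->
  u.2 < cap_height%:Z -> escapes u.
Proof.
move=> uv ev ul; have vu := half_sym_imp uv.
have vy : v.2 <= u.2 + q%:Z by move: (half_leap uv); rewrite /leaper_adj; lia.
have [|w [vw wC wh]] := ev; first by have := half_in vu; lia.
exists w; split=> //; apply: conn_trans vw; apply: conn1.
by rewrite /low uv ul.
Qed.

Lemma escapes_high (u : cell) : in_cols u.1 -> cap_height%:Z <= u.2 < cap_height%:Z + q%:Z -> escapes u.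
Proof. by move=> uC uh; exists u; split=> //; apply: conn0. Qed.

Lemma lat_up (y : int) b : lat (y + q%:Z) (~~ b) = ((lat y b).1, (lat y b).2 + 1).
Proof.
have [ib rE pE] := latP y b; move: ib rE pE; case: (lat y b) => c k /= cb rE pE.
apply: latE => //=; first by move: rE; rewrite /lat_row /=; lia.
by move: pE; clear; case: b; lia.
Qed.

Lemma lat_next (y : int) b : lat (y + p%:Z) (~~ b) =
  if (lat y b).1 + 1 < (2 * q)%N%:Z then ((lat y b).1 + 1, (lat y b).2)
  else (0, (lat y b).2 + (2 * p)%N%:Z).
Proof.
have [ib rE pE] := latP y b; move: ib rE pE; case: (lat y b) => c k /= cb rE pE.
apply: latE; case: ifP => cE /=.
- by lia.
- by lia.
- by move: rE; rewrite /lat_row /=; lia.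
- have {}cE : c = (2 * q)%N%:Z - 1 by lia.
  by move: rE; rewrite /lat_row /= cE; lia.
- by move: pE; clear; case: b; lia.
- have {}cE : c = (2 * q)%N%:Z - 1 by lia.
  by move: pE; rewrite cE; clear; case: b; lia.
Qed.

(** In the open part every step of the walk goes up, and leads to the open part. *)
Lemma escapes_open (x y : int) : in_cols x -> 0 <= y < cap_height%:Z + q%:Z ->
  ~~ ringed (lat y (parity (x, y))) -> escapes (x, y).
Proof.
have [n] := ubnP (absz (cap_height%:Z + q%:Z - y)%R); elim: n x y => // n IH x y yn xC yb op.
have [yh|yh] := ltrP y cap_height%:Z; last by apply: escapes_high => //=; lia.
have [ib rE _] := latP y (parity (x, y)).
case PE: (capP (lat y (parity (x, y)))).
  apply: (@escapes_step _ (sig x, y + p%:Z)) => //=.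
    by rewrite /half /= xC eqxx /rowP PE; case/andP: yb => ->.
  move=> y'b; apply: IH => //; [lia|exact: sig_in|].
  rewrite (@parity_sig x y) ?lat_next; last by lia.
  move: PE op ib; rewrite /capP; case: (lat _ _) => c k /= PE op ib.
  move: PE; rewrite (negPf op) => /andP[ck _].
  by move: op; rewrite /ringed /=; case: ifP => /=; lia.
apply: (@escapes_step _ (tau x, y + q%:Z)) => //=.
  have /andP[y_ge _] := yb; rewrite /half /= xC eqxx /rowQ y_ge.
  rewrite (surjective_pairing (lat _ _)) open_outQ -?surjective_pairing ?PE ?orbT //; rewrite rE; lia.
move=> y'b; apply: IH => //; [lia|exact: tau_in|].
rewrite (@parity_tau x y) ?lat_up; last by lia.
by move: op; rewrite /ringed /=; lia.
Qed.

(** In the ringed part c - k increases along the walk, while it is bounded because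
    the row is not negative; so c reaches 2q and the walk enters the open part. *)
Lemma escapes_any (x y : int) : in_cols x -> 0 <= y < cap_height%:Z + q%:Z -> escapes (x, y).
Proof.
pose d (i : int * int) := i.1 - i.2.
have [n] := ubnP (absz ((2 * p + 2 * q)%N%:Z - d (lat y (parity (x, y))))%R).
elim: n x y => // n IH x y yn xC yb.
have [yh|yh] := ltrP y cap_height%:Z; last by apply: escapes_high => //=; lia.
have [op|rg] := boolP (~~ ringed (lat y (parity (x, y)))); first exact: escapes_open.
rewrite negbK in rg.
have [ib rE _] := latP y (parity (x, y)).
have k_bd : - (2 * p)%N%:Z <= (lat y (parity (x, y))).2.
  rewrite leNgt; apply/negP => k_lt; have := mid_rowE.
  move: rE; rewrite /lat_row; move: ib k_lt; case: (lat _ _) => c k /= cb k_lt rE.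
  have := mulr_ge0 (x := (2 * q)%N%:Z - 1 - c) (y := p%:Z).
  by have := mulr_ge0 (x := - (2 * p)%N%:Z - 1 - k) (y := q%:Z); lia.
case PE: (capP (lat y (parity (x, y)))).
  apply: (@escapes_step _ (sig x, y + p%:Z)) => //=.
    by rewrite /half /= xC eqxx /rowP PE; case/andP: yb => ->.
  move=> y'b; have [wrap|] := boolP ((lat y (parity (x, y))).1 + 1 < (2 * q)%N%:Z).
    apply: IH => //; last exact: sig_in.
    rewrite (@parity_sig x y) ?lat_next ?wrap; last by lia.
    by move: yn k_bd ib; rewrite /d; clear; case: (lat y _) => c k /=; lia.
  move=> wrap; apply: escapes_open => //; first exact: sig_in.
  rewrite (@parity_sig x y) ?lat_next ?(negPf wrap); last by lia.
  by move: k_bd; clear -p_gt0; rewrite /ringed; case: (lat y _) => c k /=; lia.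
have r0 : 0 <= lat_row (lat y (parity (x, y))) by rewrite rE; lia.
have := @ringed_inQ (lat y (parity (x, y))).1 (lat y (parity (x, y))).2.
rewrite -surjective_pairing PE => /(_ ib r0 rg) /andP[y_ge Q]; rewrite rE in y_ge.
apply: (@escapes_step _ (tau x, y - q%:Z)) => //=.
  by rewrite /half /= xC eqxx /rowQ lat_down y_ge Q /= !orbT.
move=> y'b; apply: IH => //; last exact: tau_in.
rewrite (@parity_tau x y) ?lat_down; last by lia.
by move: yn k_bd ib; rewrite /d; clear; case: (lat y _) => c k /=; lia.
Qed.

(** ** The whole strip *)

Section Board.

Variable m : nat.
Let mid : int := cap_height%:Z + q%:Z + 1.
Hypothesis m_big : (2 * (cap_height + q + 1) <= m)%N.

Definition turn (u : cell) : cell := (u.1, m%:Z - 1 - u.2).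

Definition base : rel cell := fun u v => if u.2 < mid then half u v else half (turn u) (turn v).

Lemma turnK : involutive turn.
Proof. by move=> [x y]; rewrite /turn /= subKr. Qed.

Lemma leap_turn (u v : cell) : leap (turn u) (turn v) = leap u v.
Proof.
rewrite /leaper_adj /turn /=.
by have -> : absz (m%:Z - 1 - u.2 - (m%:Z - 1 - v.2))%R = absz (u.2 - v.2)%R by lia.
Qed.

(** Both halves consist of strands where they meet, so they agree there. *)
Lemma half_turn (u v : cell) : cap_height%:Z <= u.2 < m%:Z - cap_height%:Z ->
  half (turn u) (turn v) = half u v.
Proof.
case: u => x y /= yb; have [xC|xC] := boolP (in_cols x); last by rewrite /half /= (negPf xC).
have yb' : cap_height%:Z <= m%:Z - 1 - y < m%:Z by lia.
rewrite /turn [LHS](half_pure _ xC yb') (half_pure _ xC yb) -/(turn v).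
have tE y' : (turn v == (tau x, y')) = (v == (tau x, m%:Z - 1 - y')).
  by rewrite (can2_eq turnK turnK).
rewrite !tE orbC; congr ((v == (_, _)) || (v == (_, _))); lia.
Qed.

Lemma leap_rows (u v : cell) : leap u v -> u.2 - q%:Z <= v.2 <= u.2 + q%:Z.
Proof.
case: u v => x y [x' y']; rewrite /leaper_adj /=; clear -lt_pq.
by case/orP=> /andP[_ /eqP yE]; lia.
Qed.

Lemma base_sym : symmetric base.
Proof.
suff imp (u v : cell) : base u v -> base v u by move=> u v; apply/idP/idP; apply: imp.
rewrite /base; have [u_low|u_high] := ltrP u.2 mid; have [v_low|v_high] := ltrP v.2 mid.
- by rewrite half_sym.
- move=> uv; have uv_rows := leap_rows (half_leap uv).
  by rewrite half_turn 1?half_sym //; move: uv_rows u_low v_high; rewrite /mid; clear -m_big; lia.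
- move=> uv; have := half_leap uv; rewrite leap_turn => /leap_rows uv_rows.
  have u_mid : cap_height%:Z <= u.2 < m%:Z - cap_height%:Z.
    by move: uv_rows u_high v_low; rewrite /mid; clear -m_big; lia.
  by rewrite half_sym -half_turn.
by rewrite half_sym.
Qed.

Lemma base_factor : factor leap (strip 0 m%:Z) base.
Proof.
split=> [|u v|u v|u].
- exact: base_sym.
- rewrite /base; case: ifP => _; first exact: half_leap.
  by move/half_leap; rewrite leap_turn.
- rewrite /base -topredE /= /strip; case: ltrP => u_mid /half_in /= /andP[-> u0].
    by move: u_mid u0; rewrite /mid; lia.
  by move: u_mid u0; rewrite /mid; lia.
rewrite -topredE /= /strip => /andP[uC u_b].
have [u_low|u_high] := ltrP u.2 mid.
  have [|a [b [ab Fu]]] := half_two uC; first by case/andP: u_b.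
  by exists a, b; split=> // v; rewrite /base u_low.
have [||a [b [ab Fu]]] := @half_two (turn u); rewrite /turn //=; first by lia.
exists (turn a), (turn b); split; first by rewrite (inj_eq (inv_inj turnK)).
move=> v; rewrite /base ltNge u_high /= Fu.
by rewrite !(can2_eq turnK turnK).
Qed.

Lemma base_pure : pure base cap_height%:Z (m%:Z - cap_height%:Z).
Proof.
move=> x y v xC yb; rewrite /base /=; have yb' : cap_height%:Z <= y < m%:Z by lia.
by case: ifP => _; rewrite ?half_turn // (half_pure _ xC yb').
Qed.

Lemma low_base (u v : cell) : low u v -> base u v /\ base (turn u) (turn v).
Proof.
case/andP=> uv uv_low; have uv_rows := leap_rows (half_leap uv).
have u_low : u.2 < mid by move: uv_low uv_rows; rewrite /mid; clear; lia.
by rewrite /base u_low /= ltNge (_ : mid <= _) /= ?turnK //; move: u_low; rewrite /mid; lia.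
Qed.

Lemma base_escapes (u : cell) : u \in strip 0 m%:Z -> exists v : cell,
  [/\ conn base u v, in_cols v.1 & cap_height%:Z <= v.2 < m%:Z - cap_height%:Z].
Proof.
case: u => x y; rewrite -topredE /= /strip /= => /andP[xC yb].
have [y_low|y_mid] := ltrP y cap_height%:Z.
  have [|v [xv vC vb]] := @escapes_any x y xC; first by lia.
  exists v; split=> //; last by lia.
  by apply: (conn_map (r := id)) xv => ? ? /low_base[? _]; apply: conn1.
have [y_high|y_mid'] := ltrP y (m%:Z - cap_height%:Z); last first.
  have [|v [xv vC vb]] := @escapes_any x (m%:Z - 1 - y) xC; first by lia.
  exists (turn v); split=> //; last by rewrite /turn /=; lia.
  rewrite -(turnK (x, y)); apply: (conn_map (r := turn)) xv => ? ? /low_base[_ ?].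
  exact: conn1.
by exists (x, y); split=> //; [apply: conn0|rewrite y_mid].
Qed.

End Board.

Lemma strip_hamiltonian : exists m0 : nat, forall m : nat, (m0 <= m)%N ->
  exists s, hamiltonian_cycle (strip 0 m%:Z) leap s.
Proof.
(* One list of merges connects all strands to the strand of the origin. *)
pose L : seq (cell * cell) :=
  [seq ((0, 0), (x%:Z, y%:Z)) | x <- iota 0 W, y <- iota 0 (2 * q)].
have W_gt0 : (0 < W)%N by rewrite !muln_gt0 p_gt0.
have zeroC : in_cols 0 by rewrite /in_cols; lia.
have LE (x y : int) : in_cols x -> 0 <= y < (2 * q)%N%:Z -> ((0, 0), (x, y)) \in L.
  move=> xC yb; apply/allpairsP; exists (absz x, absz y); rewrite !mem_iota.
  move: xC; rewrite /in_cols => xC; split=> /=; [lia|lia|].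
  by congr (_, (_, _)); lia.
have [_ [h hq M]] : mergeable L.
  apply: mergeable_all => s s' /allpairsP[[x y] [/=]]; rewrite !mem_iota => xW yq [-> ->].
  by apply: merges_any => //; rewrite /in_cols /=; lia.
exists (2 * (cap_height + q + 1) + h)%N => m m_big.
have m_big' : (2 * (cap_height + q + 1) <= m)%N by lia.
have Ff := base_factor m_big'; have Fp := base_pure m_big'.
have Fp' : pure (base m) cap_height%:Z (cap_height%:Z + h%:Z).
  by apply: pure_sub Fp _ _; lia.
have [F [F_f FF Fc FL]] := M _ _ _ _ Ff Fp'.
have [symF Fl FV F2] := F_f.
have symB : symmetric (base m) by case: Ff.
have [t0 t0b] := row_in 0 cap_height%:Z.
pose hub : cell := (0, (2 * q)%N%:Z * t0).
have to_hub u : u \in strip 0 m%:Z -> conn F hub u.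
  move=> us; have [[x y] [uv /= xC yb]] := base_escapes m_big' us.
  have [t1 t1b] := row_in y 0; have [t2 t2b] := row_in y cap_height%:Z.
  apply: (@conn_trans _ _ (x, y + (2 * q)%N%:Z * t2)); last first.
    apply: conn_sym => //; apply: conn_trans (Fc _ _ uv) _; apply: Fc.
    by apply: (conn_strand2 (t := t2) symB Fp xC) => //; lia.
  have := FL _ _ t0 (t2 - t1) (LE x (y + (2 * q)%N%:Z * t1) xC _) _ _.
  rewrite /= add0r (_ : y + _ + _ = y + (2 * q)%N%:Z * t2); last by lia.
  by apply; lia.
have [l lV] := strip_enum 0 m%:Z.
have irrF : irreflexive F by move=> w; apply/negP => /Fl; rewrite leap_irr.
apply: (@connected_hamiltonian _ F leap _ l hub) => //.
rewrite -topredE /= /strip /= zeroC; lia.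
Qed.

End Strip.

Local Close Scope ring_scope.

(** * Tours of all tall boards *)

Lemma leaper_adjC p q : leaper_adj p q =2 leaper_adj q p.
Proof. by move=> u v; rewrite /leaper_adj orbC. Qed.

Lemma hamiltonian_cycle_map (T : eqType) (V V' : pred T) (e e' : rel T) (r r' : T -> T) s :
  cancel r r' -> cancel r' r -> (forall u, V' u = V (r' u)) ->
  (forall u v, e u v -> e' (r u) (r v)) ->
  hamiltonian_cycle V e s -> hamiltonian_cycle V' e' (map r s).
Proof.
move=> rK r'K VV ee [s_gt2 /andP[s_cycle s_uniq] sV]; split; first by rewrite size_map.
  rewrite /ucycle map_inj_uniq ?s_uniq ?andbT; last exact: can_inj rK.
  exact: (homo_cycle ee).
by move=> u; rewrite -{1}(r'K u) (mem_map (can_inj rK)) sV -!topredE /= VV.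
Qed.

Theorem theorem1 (p q : nat) (Hpq : skew_free p q) :
  exists m0 : nat, 0 < m0 /\
    forall m : nat, m0 <= m ->
      forall B : board, height B = m -> width B = 4 * p * q -> tours p q B.
Proof.
wlog lt_pq : p q Hpq / p < q => [hwlog|].
  case: (Hpq) => p_gt0 q_gt0; rewrite neq_ltn => /orP[pq|qp] odd_pq co_pq; first exact: hwlog.
  have [|m0 [m0_gt0 Hm0]] := hwlog q p _ qp.
    by split; rewrite // 1?neq_ltn ?qp // 1?addnC // gcdnC.
  exists m0; split=> // m m_big B hB wB.
  have [|s [s2 s_cycle sV]] := Hm0 m m_big B hB; first by rewrite wB mulnAC.
  by exists s; split=> //; move: s_cycle; rewrite /ucycle (eq_cycle (leaper_adjC q p)).
case: Hpq => p_gt0 q_gt0 _ odd_pq /eqP co_pq.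
have [m0 Hm0] := strip_hamiltonian p_gt0 q_gt0 lt_pq odd_pq co_pq.
exists m0.+1; split=> // m m_big B hB wB.
have [s Hs] := Hm0 m (ltnW m_big).
pose r (u : cell) : cell := (u.1 + xmin B, u.2 + ymin B)%R.
pose r' (u : cell) : cell := (u.1 - xmin B, u.2 - ymin B)%R.
exists (map r s); apply: (hamiltonian_cycle_map (r' := r')) Hs.
- by move=> [x y]; rewrite /r /r' /= !addrK.
- by move=> [x y]; rewrite /r /r' /= !subrK.
- move=> [x y]; rewrite /cells /strip /in_cols /r' /=.
  have := board_x B; have := board_y B; move: hB wB; rewrite /height /width.
  move: (xmin B) (xmax B) (ymin B) (ymax B) (4 * p * q) => x1 x2 y1 y2 w hB wB y12 x12.
  by congr (_ && _); [clear -wB x12|clear -hB y12]; lia.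
move=> u v; rewrite /leaper_adj /r /=.
have shift (a b c : int) : absz (a + c - (b + c))%R = absz (a - b)%R by lia.
by rewrite !shift.
Qed.
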